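(* Let $\mathbb{G}$ be a graded group equipped with a homogeneous distance $d$ and with a fixed scalar product $|\cdot|$ and associated left invariant metric $g$ as in the context. Let $\tilde g$ be any Riemannian metric on $\mathbb{G}$ and let $\Sigma\subset\mathbb{G}$ be a $C^1$ smooth $1$-dimensional (embedded) submanifold of degree $d(\Sigma)=q$. Let $x\in\Sigma$ be such that $d_\Sigma(x)=q$. Then $$\lim_{r\to0^+}\frac{\tilde\mu_1(\Sigma\cap B_{x,r})}{r^q}=\frac{\theta(\tau_\Sigma^q(x))}{|\tau_\Sigma^q(x)|},$$ where $\tilde\mu_1$ is the Riemannian measure on $\Sigma$ with respect to the metric $\tilde g$.
   Context: A graded group $\mathbb{G}$ of topological dimension $n$ is a simply connected nilpotent real Lie group whose Lie algebra has a grading $\mathcal{G}=V_1\oplus\cdots\oplus V_\iota$ with $[V_i,V_j]\subset V_{i+j}$ for all $i,j\ge1$, where $V_j=\{0\}$ for $j>\iota$. Dilations are defined for $r>0$ by $\delta_r(\sum_j v_j)=\sum_j r^j v_j$, $v_j\in V_j$, and are transferred to $\mathbb{G}$ by the diffeomorphism $\exp:\mathcal{G}\to\mathbb{G}$, giving group isomorphisms still denoted $\delta_r$. A homogeneous distance $d$ on $\mathbb{G}$ is a continuous distance with $d(zx,zy)=d(x,y)$ and $d(\delta_r x,\delta_r y)=r\,d(x,y)$ for all $x,y,z\in\mathbb{G}$, $r>0$. $B_{x,r}$ is the open ball of center $x$ and radius $r$ with respect to $d$, and $B_1=B_{0,1}$ is the open unit ball centered at the unit element $0$. Via $\exp$,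 $\mathbb{G}$ is identified with the graded vector space $H_1\oplus\cdots\oplus H_\iota$, $H_j=\exp V_j$, with canonical projections $p_j:\mathbb{G}\to H_j$. Let $m_0=0$ and $m_j=\sum_{l=1}^j\dim H_l$. A graded basis of $\mathbb{G}$ is a basis $(e_1,\dots,e_n)$ such that $(e_{m_{j-1}+1},\dots,e_{m_j})$ is a basis of $H_j$ for each $j=1,\dots,\iota$. One graded basis is fixed and declared orthonormal; this fixes a scalar product on $\mathbb{G}$ with norm $|\cdot|$, and the unique left invariant Riemannian metric $g$ coinciding with it at $0$ (with $T_0\mathbb{G}$ identified with $\mathbb{G}$). For $v\in T_y\mathbb{G}$, $|v|$ denotes the length with respect to $g$. The degree of $e_j$ is $d_j=k$ iff $e_j\in H_k$; $X_j$ is the left invariant vector field with $X_j(0)=e_j$; $l_x(y)=x\cdot y$ is left translation. Degree: for a $1$-dimensional submanifold $\Sigma$, $x\in\Sigma$ and $\tau\in T_x\Sigma\setminus\{0\}$, write $\tau=\sum_{j=1}^n\lambda_j X_j(x)$. The pointwise degree is $d_\Sigma(x)=\max\{d_j:\lambda_j\ne0\}$, and $d(\Sigma)=\max_{x\in\Sigma}d_\Sigma(x)$. Projections of the tangent: if $\gamma$ is a $C^1$ local parametrization of $\Sigma$ with $\gamma(t)=x$, the unit tangent vector is $\tau_\Sigma(x)=\dot\gamma(t)/|\dot\gamma(t)|_{\tilde g}$ (unit with respect to $\tilde g$; defined up to sign), and its $j$-projection is $\tau_\Sigma^j(x)=dl_x\big(p_j(dl_{x^{-1}}(\tau_\Sigma(x)))\big)\in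 T_x\mathbb{G}$. Metric factor: for $\tau\in T_x\mathbb{G}$ set $\tau_0=dl_{x^{-1}}\tau\in T_0\mathbb{G}\cong\mathbb{G}$; then $\theta(\tau)=\mathcal{H}^1_{|\cdot|}\left(\mathrm{span}\{\tau_0\}\cap B_1\right)$, where $\mathcal{H}^1_{|\cdot|}$ is the one-dimensional Hausdorff measure with respect to the norm $|\cdot|$. *)

(* Defs.v *)
From HB Require Import structures.
From mathcomp Require Import all_boot all_order all_algebra.
From mathcomp Require Import all_classical all_reals all_analysis.

Set Implicit Arguments.
Unset Strict Implicit.
Unset Printing Implicit Defensive.

Import Order.TTheory GRing.Theory Num.Theory.
Import numFieldNormedType.Exports.

Local Open Scope classical_set_scope.
Local Open Scope ring_scope.

(* On finite-dimensional spaces this is the usual notion of a C^k map: all    *)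
(* iterated directional derivatives up to order k exist and are continuous.   *)
Fixpoint Ck (R : realType) (U V : normedModType R) (k : nat) (f : U -> V)
    : Prop :=
  match k with
  | 0%N => continuous f
  | k'.+1 => (forall x, differentiable f x) /\
             (forall v : U, Ck k' (fun x => 'D_v f x))
  end.

Definition smooth (R : realType) (U V : normedModType R) (f : U -> V) : Prop :=
  forall k, Ck k f.

(* A group law m on R^n; the tangent space at 0 is R^n itself.                *)
Section LieGroupInCoordinates.
Context (R : realType) (n : nat).
Implicit Types (m : 'rV[R]_n -> 'rV[R]_n -> 'rV[R]_n) (x y u v : 'rV[R]_n).

(* dl m z y v is the differential of the left translation l_z at y applied to *)
(* the tangent vector v at y.                                                 *)
Definition dl m z y v : 'rV[R]_n := 'D_v (m z) y.

Definition left_inv_field m v x : 'rV[R]_n := dl m x 0 v.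

(* Value at 0 of the bracket [X, Y] = DY(X) - DX(Y) of the left invariant     *)
(* vector fields X, Y with X(0) = u and Y(0) = v.                             *)
Definition lie_bracket m u v : 'rV[R]_n :=
  'D_u (left_inv_field m v) 0 - 'D_v (left_inv_field m u) 0.

(* The layer V_k, when the degree of the j-th basis vector is dg j.           *)
Definition layer (dg : 'I_n -> nat) (k : nat) : set 'rV[R]_n :=
  [set v | forall j, dg j != k -> v 0 j = 0].

End LieGroupInCoordinates.

(* A graded group in exponential coordinates, relative to the fixed graded    *)
(* basis: the group, its Lie algebra and R^n are identified through exp and   *)
(* this basis, so that e_j is the j-th vector of the standard basis of R^n    *)
(* and the scalar product making (e_1, ..., e_n) orthonormal is the Euclidean *)
(* one.  That exp is the identity of R^n is expressed by gmul_exp: the        *)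
(* one-parameter subgroup with initial velocity x is t |-> t x.  In           *)
(* particular the inverse of x is - x.                                        *)
Record gradedGroup (R : realType) (n : nat) := GradedGroup {
  gdeg : 'I_n -> nat ;
  gmul : 'rV[R]_n -> 'rV[R]_n -> 'rV[R]_n ;
  gdeg_gt0 : forall j, (0 < gdeg j)%N ;
  gdeg_homo : forall i j : 'I_n, (i <= j)%N -> (gdeg i <= gdeg j)%N ;
  gmulA : forall x y z, gmul x (gmul y z) = gmul (gmul x y) z ;
  gmul0x : forall x, gmul 0 x = x ;
  gmulx0 : forall x, gmul x 0 = x ;
  gmul_smooth : smooth (fun p : 'rV[R]_n * 'rV[R]_n => gmul p.1 p.2) ;
  gmul_exp : forall (x : 'rV[R]_n) (s t : R),
    gmul (s *: x) (t *: x) = (s + t) *: x ;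
  gbracket_grading : forall (i j : nat) (u v : 'rV[R]_n),
    (0 < i)%N -> (0 < j)%N ->
    layer gdeg i u -> layer gdeg j v ->
    layer gdeg (i + j) (lie_bracket gmul u v)
}.

Section GradedGroupNotions.
Context (R : realType) (n : nat) (G : gradedGroup R n).
Implicit Types (x y z v tau : 'rV[R]_n) (d : 'rV[R]_n -> 'rV[R]_n -> R).

Definition dilation (r : R) x : 'rV[R]_n := \row_j (r ^+ gdeg G j * x 0 j).

Definition proj_layer (k : nat) x : 'rV[R]_n :=
  \row_j (if gdeg G j == k then x 0 j else 0).

Definition homogeneous_distance d : Prop :=
  [/\ (forall x y, 0 <= d x y) /\ (forall x y, d x y = 0 <-> x = y),
      (forall x y, d x y = d y x) /\
        (forall x y z, d x z <= d x y + d y z),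
      continuous (fun p : 'rV[R]_n * 'rV[R]_n => d p.1 p.2),
      (forall x y z, d (gmul G z x) (gmul G z y) = d x y) &
      (forall (r : R) x y, 0 < r ->
        d (dilation r x) (dilation r y) = r * d x y)].

Definition dball d x (r : R) : set 'rV[R]_n := [set y | d x y < r].

Definition enorm v : R := Num.sqrt (\sum_j (v 0 j) ^+ 2).

(* The length of v, tangent at y, for the left invariant metric g.            *)
Definition left_inv_norm y v : R := enorm (dl (gmul G) (- y) y v).

(* X_j(x)                                                                     *)
Definition basis_field (j : 'I_n) x : 'rV[R]_n :=
  left_inv_field (gmul G) (delta_mx 0 j) x.

Definition ediam (E : set 'rV[R]_n) : \bar R :=
  ereal_sup [set c | c = 0%E \/
    exists x y, [/\ E x, E y & c = (enorm (x - y))%:E]].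

Definition hausdorff1_delta (delta : R) (A : set 'rV[R]_n) : \bar R :=
  ereal_inf [set (\sum_(0 <= k <oo) ediam (F k))%E | F in
    [set F : nat -> set 'rV[R]_n |
      A `<=` \bigcup_k F k /\ forall k, (ediam (F k) <= delta%:E)%E]].

(* One-dimensional Hausdorff measure for the Euclidean norm.                  *)
Definition hausdorff1 (A : set 'rV[R]_n) : \bar R :=
  ereal_sup [set hausdorff1_delta delta A | delta in [set e : R | 0 < e]].

Definition line_span v : set 'rV[R]_n := [set c *: v | c in [set: R]].

(* theta(tau), for tau tangent at x.                                          *)
Definition metric_factor d x tau : \bar R :=
  hausdorff1 (line_span (dl (gmul G) (- x) x tau) `&` dball d 0 1).

(* tau^k, for tau tangent at x.                                               *)
Definition tangent_proj (k : nat) x tau : 'rV[R]_n :=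
  dl (gmul G) x 0 (proj_layer k (dl (gmul G) (- x) x tau)).

End GradedGroupNotions.

Section Curves.
Context (R : realType) (n : nat).
Implicit Types (Sigma : set 'rV[R]_n) (gamma : R -> 'rV[R]_n).

(* gamma, restricted to ]a, b[, is a C^1 local parametrization of Sigma: a C^1 *)
(* immersion which is a homeomorphism onto an open subset of Sigma.  The last *)
(* clause says that gamma maps open subsets of ]a, b[ to relatively open      *)
(* subsets of Sigma.                                                          *)
Definition local_param Sigma gamma (a b : R) : Prop :=
  [/\ a < b,
      (forall t, t \in `]a, b[ ->
        [/\ derivable gamma t 1, {for t, continuous (derive1 gamma)} &
            derive1 gamma t != 0]),
      {in `]a, b[ &, injective gamma} &
      forall V : set R, open V -> V `<=` [set` `]a, b[] ->
        exists2 U : set 'rV[R]_n, open U & gamma @` V = Sigma `&` U].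

(* C^1 embedded one-dimensional submanifolds                                  *)
Definition C1_curve Sigma : Prop :=
  forall x, Sigma x -> exists gamma a b t,
    [/\ local_param Sigma gamma a b, t \in `]a, b[ & gamma t = x].

Definition tangent_space Sigma (x : 'rV[R]_n) : set 'rV[R]_n :=
  [set v | exists gamma a b t (c : R),
    [/\ local_param Sigma gamma a b, t \in `]a, b[, gamma t = x &
        v = c *: derive1 gamma t]].

(* d_Sigma(x) = k                                                             *)
Definition has_pointwise_degree (G : gradedGroup R n) Sigma (x : 'rV[R]_n)
    (k : nat) : Prop :=
  exists (tau : 'rV[R]_n) (lambda : 'I_n -> R),
    [/\ tangent_space Sigma x tau, tau != 0,
        tau = \sum_j lambda j *: basis_field G j x &
        k = (\max_(j | (lambda j != 0)%R) gdeg G j)%N].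

(* d(Sigma) = q                                                               *)
Definition has_degree (G : gradedGroup R n) Sigma (q : nat) : Prop :=
  (exists2 x, Sigma x & has_pointwise_degree G Sigma x q) /\
  (forall x k, Sigma x -> has_pointwise_degree G Sigma x k -> (k <= q)%N).

(* A Riemannian metric on R^n, given by its Gram matrices in the standard     *)
(* coordinates.                                                               *)
Definition riemannian_metric (h : 'rV[R]_n -> 'M[R]_n) : Prop :=
  [/\ smooth h, (forall x, (h x)^T = h x) &
      forall x (v : 'rV[R]_n), v != 0 -> 0 < (v *m h x *m v^T) 0 0].

Definition rnorm (h : 'rV[R]_n -> 'M[R]_n) (x v : 'rV[R]_n) : R :=
  Num.sqrt ((v *m h x *m v^T) 0 0).

(* tau is one of the two values of tau_Sigma(x).                              *)
Definition unit_tangent (h : 'rV[R]_n -> 'M[R]_n) Sigma (x tau : 'rV[R]_n)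
    : Prop :=
  exists gamma a b t,
    [/\ local_param Sigma gamma a b, t \in `]a, b[, gamma t = x &
        tau = (rnorm h x (derive1 gamma t))^-1 *: derive1 gamma t].

(* The Riemannian measure of Sigma for the metric h, as a Borel measure on    *)
(* R^n: it is the unique Borel measure concentrated on Sigma which, on the    *)
(* image of any local parametrization gamma, is the image of the measure      *)
(* |gamma'(t)|_h dt (a one-dimensional sqrt(det h)).                          *)
Definition riemannian_measure (h : 'rV[R]_n -> 'M[R]_n) Sigma
    (mu : {measure set (g_sigma_algebraType (@open 'rV[R]_n)) -> \bar R})
    : Prop :=
  mu (~` Sigma) = 0%E /\
  forall gamma a b, local_param Sigma gamma a b ->
  forall E : set (g_sigma_algebraType (@open 'rV[R]_n)), measurable E ->
    mu (E `&` (gamma @` [set` `]a, b[])) =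
    (\int[lebesgue_measure]_(t in [set` `]a, b[] `&` gamma @^-1` E)
        (rnorm h (gamma t) (derive1 gamma t))%:E)%E.

End Curves.

(* Main.v *)
Require Import Defs.
From HB Require Import structures.
From mathcomp Require Import all_boot all_order all_algebra.
From mathcomp Require Import all_classical all_reals all_analysis.
From mathcomp Require Import measurable_realfun ring lra.

Set Implicit Arguments.
Unset Strict Implicit.
Unset Printing Implicit Defensive.

Import Order.TTheory GRing.Theory Num.Theory.
Import numFieldNormedType.Exports.

Local Open Scope classical_set_scope.
Local Open Scope ring_scope.

(** Translate the curve to the unit element: y(u) = x^-1 gamma(t0 + u).  Its
    derivative is the left invariant field with value lam(u) at 0, where lam is
    the velocity of gamma read in the Lie algebra through the Maurer-Cartan
    form.  As the curve has degree q, lam(u) has no component of degree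
    greater than q; let c be the component of lam(0) of degree exactly q,
    which is not zero since the point has degree q.

    Blow up: delta_(1/r) y(r^q) tends to c as r tends to 0 ([curve_blowup]).
    For coordinates of degree at most q this is only differentiability at 0.
    For a coordinate of degree k > q the homogeneity of left invariant fields
    makes its derivative at r^q equal to r^(k - q) times a quantity that
    depends continuously on the rescaled coordinates of degree less than k.
    By induction on the degree, that quantity tends to the k-coordinate, at c,
    of the left invariant field generated by c.  This field is constant along
    its one-parameter subgroup s |-> s c, so the limit is c_k = 0, and the mean
    value theorem shows that the coordinate itself is o(r^k).

    By homogeneity of d, the limit says that d(x, gamma(t))^q is equivalent to
    d(0, c)^q |t - t0| ([hdist_curve]).  So the part of the curve in the ball
    of radius r is, up to a factor tending to 1, the image of the interval of
    half-length r^q / d(0, c)^q around t0, and its measure divided by r^q tends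
    to 2 |gamma'(t0)| / d(0, c)^q ([ball_measure_bounds]).  On the other side,
    the q-projection of the unit tangent, moved to 0, is w = c / |gamma'(t0)|;
    since d(0, s w)^q = |s| d(0, w)^q, the line spanned by w meets the unit
    ball in a segment of half-length |w| / d(0, w)^q, and the ratio of the
    metric factor to |w| is 2 / d(0, w)^q, which is the same number
    ([metric_factor_ratio]).

    Only the Lie bracket is known to respect the grading, so the homogeneity of
    left invariant fields has to be integrated from the Lie algebra.  In
    exponential coordinates squaring is doubling, which forces conjugation
    v |-> y v y^-1 to be linear ([Ad_derive0]).  Along a ray it solves
    E' = [y, E], a linear system that is triangular for the grading, so it
    commutes with dilations ([Ad_dilation]); the Maurer-Cartan form along a ray
    has derivative Ad(-s y) v, so it commutes with them too
    ([maurer_cartan_dilation]). *)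

(** * Directional derivatives *)

Section Calculus.
Context (R : realType).

Lemma is_derive_along (U V : normedModType R) (f : U -> V) (x v : U) (t : R) :
  derivable f (x + t *: v) v ->
  is_derive t (1 : R) (fun s : R => f (x + s *: v)) ('D_v f (x + t *: v)).
Proof.
have E : (fun h : R => h^-1 *:
      (((fun s : R => f (x + s *: v)) \o shift t) (h *: 1) - f (x + t *: v))) =
    (fun h => h^-1 *: ((f \o shift (x + t *: v)) (h *: v) - f (x + t *: v))).
  apply/funext => h /=; congr (_ *: (f _ - _)).
  by rewrite [h *: 1]mulr1 scalerDl addrCA.
by move=> df; split; rewrite /derivable /derive E.
Qed.

(** On the line through x in the direction v the inner map is a function of one
    variable, and there its derivability is differentiability. *)
Lemma is_derive_chain (T U V : normedModType R) (g : T -> U) (f : U -> V) (x v : T) (dg : U) :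
  is_derive x v g dg -> differentiable f (g x) ->
  is_derive x v (f \o g) ('D_dg f (g x)).
Proof.
move=> [dgx dgE] dfx.
have g0 : (fun h : R => g (h *: v + x)) 0 = g x by rewrite scale0r add0r.
have d1 : differentiable (fun h : R => g (h *: v + x)) 0.
  by apply/derivable1_diffP; exact: (derivable1P g x v).1.
have d2 : differentiable (f \o (fun h : R => g (h *: v + x))) 0.
  by apply: differentiable_comp => //=; rewrite g0.
have E (W : normedModType R) (k : T -> W) : 'D_v k x = 'D_(1 : R) (fun h : R => k (h *: v + x)) 0.
  rewrite /derive; set g1 := fun h => h^-1 *: _; set g2 := fun h => h^-1 *: _.
  suff -> : g1 = g2 by []; apply/funext => h; rewrite /g1 /g2 /=.
  by rewrite addr0 scale0r add0r [h *: 1]mulr1.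
split; first by apply: (derivable1P (f \o g) x v).2; apply/derivable1_diffP.
rewrite E (_ : (fun h : R => _) = f \o (fun h : R => g (h *: v + x))) //.
rewrite deriveE // diff_comp//=; last by rewrite g0.
have -> : 'd (fun h : R => g (h *: v + x)) 0 1 = dg by rewrite -deriveE // -dgE E.
by rewrite scale0r add0r deriveE.
Qed.

Lemma is_derive_pair (T U V : normedModType R) (f : T -> U) (g : T -> V) (x v : T) df dg :
  is_derive x v f df -> is_derive x v g dg ->
  is_derive x v (fun y => (f y, g y)) (df, dg).
Proof.
move=> [f1 f2] [g1 g2].
have C : h^-1 *: (((fun y => (f y, g y)) \o shift x) (h *: v) - (f x, g x)) @[h --> 0^']
    --> (df, dg).
  rewrite -f2 -g2.
  exact: cvg_pair f1 g1.
by split; [apply/cvg_ex; eexists; exact: C|exact/cvg_lim].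
Qed.

Lemma derive_linear (U V : normedModType R) (f : U -> V) (x : U) (c : R) (u v : U) :
  differentiable f x -> 'D_(c *: u + v) f x = c *: 'D_u f x + 'D_v f x.
Proof. by move=> df; rewrite !deriveE // linearP. Qed.

Lemma is_derive_comp1 (V : normedModType R) (f : R -> R) (g : R -> V)
    (t df : R) (dg : V) :
  is_derive t (1 : R) f df -> is_derive (f t) (1 : R) g dg ->
  is_derive t (1 : R) (g \o f) (df *: dg).
Proof.
move=> hf [gd <-]; have dg' : differentiable g (f t) by apply/derivable1_diffP.
have := is_derive_chain hf dg'.
have := derive_linear df (1 : R) (0 : R) dg'.
by rewrite derive0 !addr0 [_ *: (1 : R)]mulr1 => ->.
Qed.

Lemma derive_sum_basis n (V : normedModType R) (f : 'rV[R]_n -> V) (x v : 'rV[R]_n) :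
  differentiable f x ->
  'D_v f x = \sum_j v 0 j *: 'D_(delta_mx 0 j) f x.
Proof.
move=> df; rewrite {1}[v]row_sum_delta deriveE // linear_sum /=.
by apply: eq_bigr => j _; rewrite linearZ /= deriveE.
Qed.

Lemma is_derive_coord (U : normedModType R) n (f : U -> 'rV[R]_n) (x v : U) (df : 'rV[R]_n) j :
  is_derive x v f df -> is_derive x v (fun y => f y 0 j) (df 0 j).
Proof.
move=> [h1 <-]; split; first by have /derivable_mxP := h1; exact.
by rewrite derive_mx // mxE.
Qed.

Lemma is_derive_row (U : normedModType R) n (f : U -> 'rV[R]_n) (x v : U) (df : 'rV[R]_n) :
  (forall j, is_derive x v (fun y => f y 0 j) (df 0 j)) -> is_derive x v f df.
Proof.
move=> h; have d : derivable f x v by apply/derivable_mxP => i j; rewrite ord1; have [] := h j.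
by split => //; rewrite derive_mx //; apply/rowP => j; rewrite mxE; have [] := h j.
Qed.

Lemma cvg_row n (T : Type) (F : set_system T) {FF : Filter F} (f : T -> 'rV[R]_n) (l : 'rV[R]_n) :
  (forall j, f y 0 j @[y --> F] --> l 0 j) -> f y @[y --> F] --> l.
Proof.
move=> h; apply/cvgrPdist_le => /= e e0.
near=> y.
rewrite /Num.Def.normr/= mx_normrE (bigmax_le _ (ltW e0))//= => i _.
rewrite !mxE (ord1 i.1); move: i; near: y; apply: filter_forall => /= i.
exact: ((cvgrPdist_le _ _).1 (h i.2)).
Unshelve. all: by end_near. Qed.

Lemma cvg_coord n (T : Type) (F : set_system T) {FF : Filter F}
    (f : T -> 'rV[R]_n) (l : 'rV[R]_n) j :
  f y @[y --> F] --> l -> f y 0 j @[y --> F] --> l 0 j.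
Proof.
move=> h; apply: (@continuous_cvg _ _ _ F FF f (fun M : 'rV[R]_n => M 0 j) l) => //.
exact: coord_continuous.
Qed.

Lemma smooth_derive (U V : normedModType R) (f : U -> V) v : smooth f -> smooth (fun x => 'D_v f x).
Proof. by move=> sf k; have [_] := sf k.+1; exact. Qed.

Lemma smooth_differentiable (U V : normedModType R) (f : U -> V) x : smooth f -> differentiable f x.
Proof. by move=> sf; have [h _] := sf 1%N; exact: h. Qed.

Lemma smooth_continuous (U V : normedModType R) (f : U -> V) : smooth f -> continuous f.
Proof. by move=> sf; exact: (sf 0%N). Qed.

(** Two applications of the mean value theorem turn the second difference over
    a square into an iterated derivative, taken in either order; comparing the
    two orders gives the symmetry of second derivatives. *)
Lemma second_difference (U : normedModType R) (F Fv Fvu : U -> R) (u v x : U) (h : R) :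
  0 < h -> (forall y, is_derive y v F (Fv y)) ->
  (forall y, is_derive y u Fv (Fvu y)) ->
  exists s t, [/\ 0 < s < h, 0 < t < h &
    F (x + h *: u + h *: v) - F (x + h *: u) - F (x + h *: v) + F x =
    h ^+ 2 * Fvu (x + s *: u + t *: v)].
Proof.
move=> h0 dF dFv.
have along (g dg : U -> R) w y t : (forall y, is_derive y w g (dg y)) ->
    is_derive t (1 : R) (fun s : R => g (y + s *: w)) (dg (y + t *: w)).
  by move=> gE; have [gd <-] := gE (y + t *: w); exact: is_derive_along.
have cont (f df : R -> R) : (forall t, is_derive t (1 : R) f (df t)) ->
    {within `[0, h], continuous f}.
  by move=> fE; apply: derivable_within_continuous => t _; have [] := fE t.
have d1 t : is_derive t (1 : R) (fun t : R => F (x + h *: u + t *: v) - F (x + t *: v))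
    (Fv (x + h *: u + t *: v) - Fv (x + t *: v)).
  by apply: is_deriveB; exact: along.
have [t] := MVT h0 (fun t _ => d1 t) (cont _ _ d1).
rewrite in_itv /= => th E1.
have d2 s := along _ _ _ (x + t *: v) s dFv.
have [s] := MVT h0 (fun s _ => d2 s) (cont _ _ d2).
rewrite in_itv /= => sh E2.
exists s, t; split => //.
move: E1 E2; rewrite !scale0r !addr0 !subr0 => E1 E2.
have -> : F (x + h *: u + h *: v) - F (x + h *: u) - F (x + h *: v) + F x =
  (F (x + h *: u + h *: v) - F (x + h *: v)) - (F (x + h *: u) - F x) by ring.
rewrite E1 [x + h *: u + _]addrAC E2 [x + s *: u + _]addrAC.
ring.
Qed.

Lemma schwarz_real (U : normedModType R) (F Fu Fv G1 G2 : U -> R) (u v x : U) :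
  (forall y, is_derive y u F (Fu y)) -> (forall y, is_derive y v F (Fv y)) ->
  (forall y, is_derive y u Fv (G1 y)) -> (forall y, is_derive y v Fu (G2 y)) ->
  {for x, continuous G1} -> {for x, continuous G2} -> G1 x = G2 x.
Proof.
move=> dFu dFv dG1 dG2 cG1 cG2.
have sd1 := fun h h0 => @second_difference U F Fv G1 u v x h h0 dFv dG1.
have sd2 := fun h h0 => @second_difference U F Fu G2 v u x h h0 dFu dG2.
apply/eqP; rewrite -subr_eq0 -normr_le0; apply/ler_addgt0Pl => e e0; rewrite addr0.
have near_box (G : U -> R) : {for x, continuous G} ->
    \forall h \near 0^'+, forall s t : R, 0 < s < h -> 0 < t < h ->
      `|G x - G (x + s *: u + t *: v)| <= e / 2.
  move=> /cvgrPdist_le /(_ (e / 2)); rewrite divr_gt0// => /(_ isT).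
  move=> /nbhs_ballP[d /= d0 dG].
  have B0 : 0 < `|u| + `|v| + 1 by rewrite ltr_wpDl // addr_ge0.
  near=> h => s t /andP[s0 sh] /andP[t0 th].
  apply: dG; rewrite -ball_normE /= -addrA opprD addrA subrr add0r normrN.
  apply: (@le_lt_trans _ _ (h * (`|u| + `|v| + 1))).
    apply: (le_trans (ler_normD _ _)); rewrite !normrZ !gtr0_norm //.
    rewrite !mulrDr; have := normr_ge0 u; have := normr_ge0 v; nra.
  rewrite -ltr_pdivlMr //; near: h; apply: nbhs_right_lt; exact: divr_gt0.
have [h [h0 [n1 n2]]] := filter_ex
  (filterI (nbhs_right_gt 0) (filterI (near_box _ cG1) (near_box _ cG2))).
have [s [t [hs ht E1]]] := sd1 h h0.
have [t' [s' [ht' hs' E2]]] := sd2 h h0.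
have /mulfI E3 : h ^+ 2 != 0 by rewrite expf_neq0 // gt_eqF.
have E : G1 (x + s *: u + t *: v) = G2 (x + s' *: u + t' *: v).
  apply: E3; rewrite -E1 [x + s' *: u + _]addrAC -E2 [x + h *: v + h *: u]addrAC.
  by move: (F _) (F _) (F _) (F _) => a b c d; ring.
have := n1 _ _ hs ht; have := n2 _ _ hs' ht'; rewrite E.
move: (G1 _) (G2 _) (G2 _) => a b c.
rewrite !ler_norml => /andP[? ?] /andP[? ?]; apply/andP; split; lra.
Unshelve. all: by end_near. Qed.

Lemma schwarz (U : normedModType R) n (f : U -> 'rV[R]_n) (u v x : U) : smooth f ->
  'D_u (fun z => 'D_v f z) x = 'D_v (fun z => 'D_u f z) x.
Proof.
move=> sf.
have dE (g : U -> 'rV[R]_n) w y : smooth g -> is_derive y w g ('D_w g y).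
  by move=> sg; apply: derivableP; exact/diff_derivable/smooth_differentiable.
apply/rowP => j.
have cE w w' : continuous (fun z => 'D_w ('D_w' f) z 0 j).
  move=> y; apply: cvg_coord.
  exact: (smooth_continuous (@smooth_derive _ _ _ w (@smooth_derive _ _ _ w' sf))).
apply: (schwarz_real (F := fun z => f z 0 j) (Fu := fun z => 'D_u f z 0 j)
  (Fv := fun z => 'D_v f z 0 j) (u := u) (v := v)
  (G1 := fun z => 'D_u ('D_v f) z 0 j) (G2 := fun z => 'D_v ('D_u f) z 0 j)).
- by move=> y; apply: is_derive_coord; exact: dE.
- by move=> y; apply: is_derive_coord; exact: dE.
- by move=> y; apply: is_derive_coord; apply: dE; exact: smooth_derive.
- by move=> y; apply: is_derive_coord; apply: dE; exact: smooth_derive.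
- exact: cE.
- exact: cE.
Qed.

Lemma derive_ext_row n (f g : R -> 'rV[R]_n) (df : R -> 'rV[R]_n) :
  (forall t, is_derive t (1 : R) f (df t)) -> (forall t, is_derive t (1 : R) g (df t)) ->
  f 0 = g 0 -> f =1 g.
Proof.
move=> hf hg e t; apply/rowP => j; apply/eqP; rewrite -subr_eq0; apply/eqP.
have h s : is_derive s (1 : R) (fun s => f s 0 j - g s 0 j) 0.
  by rewrite -(subrr (df s 0 j)); apply: is_deriveB; exact: is_derive_coord.
by rewrite (is_derive_0_is_cst t 0 h) e subrr.
Qed.

Lemma is_derive_translate (V : normedModType R) (f g : R -> V) (s : R) (l : V) :
  (forall h, f (h + s) = g h) -> is_derive 0 (1 : R) g l -> is_derive s (1 : R) f l.
Proof.
move=> fg [gd <-].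
have E : (fun h : R => h^-1 *: ((f \o shift s) (h *: 1) - f s)) =
    (fun h : R => h^-1 *: ((g \o shift 0) (h *: 1) - g 0)).
  by apply/funext => h /=; rewrite -{2}[s]add0r !fg addr0.
by split; rewrite /derivable /derive E.
Qed.

Lemma is_derive_unique (U V : normedModType R) (f : U -> V) (x v : U) (a b : V) :
  is_derive x v f a -> is_derive x v f b -> a = b.
Proof. by move=> [_ <-] [_ <-]. Qed.

Lemma is_derive_ext (U V : normedModType R) (f g : U -> V) (x v : U) (a : V) :
  f =1 g -> is_derive x v f a -> is_derive x v g a.
Proof. by move=> /funext ->. Qed.

Lemma is_derive_line (V : normedModType R) (x v : V) (t : R) :
  is_derive t (1 : R) (fun s : R => x + s *: v) v.
Proof.
by have := @is_derive_along V V id x v t (@derivable_id _ _ _ _); rewrite derive_id.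
Qed.

Lemma is_derive_ray (V : normedModType R) (v : V) (t : R) :
  is_derive t (1 : R) (fun s : R => s *: v) v.
Proof. by apply: is_derive_ext (is_derive_line 0 v t) => s; rewrite add0r. Qed.

End Calculus.

(** * Group law and adjoint action *)

Section Group.
Context (R : realType) (n : nat) (G : gradedGroup R n).
Local Notation V := 'rV[R]_n.
Local Notation m := (gmul G).
Local Notation M := (fun p : V * V => gmul G p.1 p.2).
Implicit Types (x y z u v w : V) (r s t : R).

Lemma gmulxN x : m x (- x) = 0.
Proof. by have := gmul_exp G x 1 (-1); rewrite !scaleN1r scale1r subrr scale0r. Qed.

Lemma gmulNx x : m (- x) x = 0.
Proof. by rewrite -{2}[x]opprK gmulxN. Qed.

Lemma gmulNKx x y : m x (m (- x) y) = y.
Proof. by rewrite gmulA gmulxN gmul0x. Qed.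

Lemma gmulxK x y : m (m y x) (- x) = y.
Proof. by rewrite -gmulA gmulxN gmulx0. Qed.

Lemma gmulxNK x y : m (m y (- x)) x = y.
Proof. by rewrite -gmulA gmulNx gmulx0. Qed.

(** In exponential coordinates the inverse of x is - x. *)
Lemma oppr_gmul x y : - m x y = m (- y) (- x).
Proof. by rewrite -[LHS](gmulxK x) -[X in m X _](gmulxK y) -[m (m _ x) y]gmulA gmulNx gmul0x. Qed.

Lemma gmul_double x : m x x = 2 *: x.
Proof. by have := gmul_exp G x 1 1; rewrite !scale1r. Qed.

Lemma differentiable_gmul (p : V * V) : differentiable M p.
Proof. exact/smooth_differentiable/gmul_smooth. Qed.

Lemma is_derive_gmul (T : normedModType R) (f g : T -> V) (x v : T) df dg :
  is_derive x v f df -> is_derive x v g dg ->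
  is_derive x v (fun p => m (f p) (g p)) ('D_(df, dg) M (f x, g x)).
Proof.
move=> hf hg.
exact: (is_derive_chain (is_derive_pair hf hg) (differentiable_gmul (f x, g x))).
Qed.

Lemma is_derive_gmull (T : normedModType R) (a : V) (g : T -> V) (x v : T) dg :
  is_derive x v g dg -> is_derive x v (fun p => m a (g p)) (dl m a (g x) dg).
Proof.
move=> hg.
have E u z : 'D_(0, u) M (a, z) = dl m a z u.
  by have [_ <-] := is_derive_gmul (is_derive_cst a z u) (is_derive_id z u).
by have := is_derive_gmul (is_derive_cst a x v) hg; rewrite E.
Qed.

Lemma dlE a y v : dl m a y v = 'D_(0, v) M (a, y).
Proof. by have [_ <-] := is_derive_gmul (is_derive_cst a y v) (is_derive_id y v). Qed.

(** Together with [dlE], this writes the differentials of left and right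
    translations as partial derivatives of the smooth map
    (x, y) |-> x y, which is where their regularity comes from. *)
Lemma drE a y v : 'D_v (fun z => m z y) a = 'D_(v, 0) M (a, y).
Proof. by have [_ <-] := is_derive_gmul (is_derive_id a v) (is_derive_cst y a v). Qed.

Lemma dlP c x y u v : dl m x y (c *: u + v) = c *: dl m x y u + dl m x y v.
Proof.
have -> : c *: u + v = (c *: (0, u) + (0, v) : V * V).2 by [].
rewrite !dlE -derive_linear; last exact: differentiable_gmul.
by rewrite -[c *: (0, u) + _]/(c *: 0 + 0, c *: u + v) /= scaler0 addr0.
Qed.

Lemma dlx0 x y : dl m x y 0 = 0.
Proof.
have := dlP 1 x y 0 0; rewrite !scale1r addr0 => /esym/eqP.
by rewrite -subr_eq0 addrK => /eqP.
Qed.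

Lemma dlZ c x y u : dl m x y (c *: u) = c *: dl m x y u.
Proof. by have := dlP c x y u 0; rewrite dlx0 !addr0. Qed.

Lemma dl_id y v : dl m 0 y v = v.
Proof. by rewrite /dl (_ : m 0 = id) ?derive_id //; apply/funext => z; exact: gmul0x. Qed.

Lemma dl_comp x y z v : dl m x (m y z) (dl m y z v) = dl m (m x y) z v.
Proof.
have h1 := is_derive_gmull x (is_derive_gmull y (is_derive_id z v)).
have h2 := is_derive_gmull (m x y) (is_derive_id z v).
apply: (is_derive_unique h1); apply: is_derive_ext h2 => t /=.
by rewrite gmulA.
Qed.

Lemma dlK x v : dl m (- x) x (dl m x 0 v) = v.
Proof. by have := dl_comp (- x) x 0 v; rewrite gmulx0 gmulNx dl_id. Qed.

Lemma dlNK x v : dl m x 0 (dl m (- x) x v) = v.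
Proof. by have := dl_comp x (- x) x v; rewrite gmulNx gmulxN dl_id. Qed.

Lemma derive_gmul0 u v : 'D_(u, v) M (0, 0) = u + v.
Proof.
have -> : (u, v) = 1 *: (u, 0) + (0, v) :> V * V.
  by rewrite scale1r -[RHS]/(u + 0, 0 + v) addr0 add0r.
rewrite derive_linear; last exact: differentiable_gmul.
rewrite scale1r -drE -dlE dl_id; congr (_ + _).
by rewrite (_ : (fun z => m z 0) = id) ?derive_id //; apply/funext => z; exact: gmulx0.
Qed.

(** Conjugation by y.  It fixes 0 and is linear ([AdP]), so it is its own
    differential at 0, the adjoint action. *)
Definition Ad y v := m (m y v) (- y).

Lemma Ad0 v : Ad 0 v = v.
Proof. by rewrite /Ad gmul0x oppr0 gmulx0. Qed.

Lemma Adx0 y : Ad y 0 = 0.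
Proof. by rewrite /Ad gmulx0 gmulxN. Qed.

Lemma Ad_comp x y v : Ad (m x y) v = Ad x (Ad y v).
Proof. by rewrite /Ad oppr_gmul !gmulA. Qed.

Lemma Ad_gmul y u v : Ad y (m u v) = m (Ad y u) (Ad y v).
Proof. by rewrite /Ad !gmulA gmulxNK. Qed.

Lemma Ad_double y v : Ad y (2 *: v) = 2 *: Ad y v.
Proof. by rewrite -!gmul_double Ad_gmul. Qed.

Lemma differentiable_Ad y v : differentiable (Ad y) v.
Proof.
apply: (@differentiable_comp _ _ _ _ (fun v => (m y v, - y)) M); last exact: differentiable_gmul.
apply: differentiable_pair; last exact: differentiable_cst.
apply: (@differentiable_comp _ _ _ _ (fun v => (y, v)) M); last exact: differentiable_gmul.
by apply: differentiable_pair.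
Qed.

(** Conjugation is an automorphism and squaring is doubling, so
    2^k Ad(y)(v / 2^k) = Ad(y) v for every k; the left side tends to the
    derivative at 0. *)
Lemma Ad_derive0 y v : Ad y v = 'D_v (Ad y) 0.
Proof.
have d : derivable (Ad y) 0 v by exact/diff_derivable/differentiable_Ad.
pose g := fun h : R => h^-1 *: ((Ad y \o shift 0) (h *: v) - Ad y 0).
have cg : g h @[h --> 0^'] --> 'D_v (Ad y) 0 by exact: d.
have cs : (2^-1 : R) ^+ k @[k --> \oo] --> (0 : R)^'.
  have c0 : (2^-1 : R) ^+ k @[k --> \oo] --> (0 : R).
    by apply: cvg_expr; rewrite gtr0_norm // invf_lt1 // ltr1n.
  move=> A /= [e e0 eA]; have [N _ hN] := c0 _ (nbhsx_ballx _ _ e0).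
  by exists N => // k Nk; apply: eA; [exact: hN | rewrite expf_neq0 // invr_eq0].
have cgs : g (2^-1 ^+ k) @[k --> \oo] --> 'D_v (Ad y) 0.
  exact: (@cvg_comp _ _ _ (fun k : nat => (2^-1 : R) ^+ k) g _ _ _ cs cg).
have gE k : g (2^-1 ^+ k) = Ad y v.
  have AE j w : Ad y (2 ^+ j *: w) = 2 ^+ j *: Ad y w.
    by elim: j w => [|j IH] w; rewrite ?expr0 ?scale1r // exprS -!scalerA Ad_double IH.
  rewrite /g /= Adx0 subr0 addr0 -[(2^-1 ^+ k)^-1]exprVn invrK -AE scalerA -exprMn.
  by rewrite mulfV // expr1n scale1r.
have : g (2^-1 ^+ k) @[k --> \oo] --> Ad y v.
  by rewrite (_ : (fun k => _) = (fun=> Ad y v)); [exact: cvg_cst|apply/funext => k; exact: gE].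
by move=> c2; have := cvg_unique _ c2 cgs; exact.
Qed.

Lemma AdP y c u v : Ad y (c *: u + v) = c *: Ad y u + Ad y v.
Proof. by rewrite !(Ad_derive0 y) derive_linear //; exact: differentiable_Ad. Qed.

Lemma AdZ y c u : Ad y (c *: u) = c *: Ad y u.
Proof. by have := AdP y c u 0; rewrite Adx0 !addr0. Qed.

Lemma gmul_Ad y v : m y v = m (Ad y v) y.
Proof. by rewrite /Ad gmulxNK. Qed.

(** Differentiate y (t v) = (t Ad(y) v) y at t = 0. *)
Lemma dl_Ad y v : dl m y 0 v = 'D_(Ad y v) (fun z => m z y) 0.
Proof.
have h1 : is_derive (0 : R) (1 : R) (fun t : R => m y (t *: v)) (dl m y 0 v).
  by have := is_derive_gmull y (is_derive_ray v 0); rewrite scale0r.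
have h2 : is_derive (0 : R) (1 : R) (fun t : R => m (t *: Ad y v) y) ('D_(Ad y v, 0) M (0, y)).
  have := is_derive_gmul (is_derive_ray (Ad y v) 0) (is_derive_cst y (0 : R) (1 : R)).
  by rewrite scale0r.
rewrite drE; apply: (is_derive_unique h1); apply: is_derive_ext h2 => t.
by rewrite [RHS]gmul_Ad AdZ.
Qed.

End Group.

(** * Lie bracket, Maurer-Cartan form and dilations *)

Section Bracket.
Context (R : realType) (n : nat) (G : gradedGroup R n).
Local Notation V := 'rV[R]_n.
Local Notation m := (gmul G).
Local Notation M := (fun p : V * V => gmul G p.1 p.2).
Local Notation dil := (dilation G).
Implicit Types (x y z u v w : V) (r s t : R).

Lemma linear_row_sum (f : V -> V) v :
  (forall c u w, f (c *: u + w) = c *: f u + f w) ->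
  f v = \sum_j v 0 j *: f (delta_mx 0 j).
Proof.
move=> fP; have fD u w : f (u + w) = f u + f w by have := fP 1 u w; rewrite !scale1r.
have f0 : f 0 = 0 by apply: (addrI (f 0)); rewrite -fD !addr0.
rewrite {1}[v]row_sum_delta (big_morph f fD f0); apply: eq_bigr => j _.
by have := fP (v 0 j) (delta_mx 0 j) 0; rewrite !addr0 f0 addr0.
Qed.

Lemma differentiable_partial_gmul (p : V * V) (d : V * V) : differentiable (fun p => 'D_d M p) p.
Proof. exact: (smooth_differentiable p (@smooth_derive _ _ _ _ d (@gmul_smooth _ _ G))). Qed.

Lemma continuous_partial_gmul (d : V * V) : continuous (fun p => 'D_d M p).
Proof. move=> p; exact/differentiable_continuous/differentiable_partial_gmul. Qed.

Lemma is_derive_left_inv_field v (u x : V) :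
  is_derive x u (left_inv_field m v) ('D_(u, 0) (fun p => 'D_(0, v) M p) (x, 0)).
Proof.
have := is_derive_chain (is_derive_pair (is_derive_id x u) (is_derive_cst (0 : V) x u))
  (differentiable_partial_gmul (x, 0) (0, v)).
by apply: is_derive_ext => z; rewrite /left_inv_field dlE.
Qed.

Lemma differentiable_left_inv_field v x : differentiable (left_inv_field m v) x.
Proof.
rewrite (_ : left_inv_field m v = (fun p => 'D_(0, v) M p) \o (fun z => (z, 0))).
  by apply: differentiable_comp; [exact: differentiable_pair|exact: differentiable_partial_gmul].
by apply/funext => z; rewrite /left_inv_field dlE.
Qed.

(** The adjoint action of the Lie algebra is the bracket.  By [dl_Ad],
    the left invariant field of v at s u is N(Ad(s u) v, s u), where N(w, z) is
    the differential at 0 of right translation by z, applied to w.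
    Differentiate at s = 0: the first argument contributes the derivative of
    Ad(s u) v, because N(w, 0) = w; the second contributes, by the symmetry of
    second derivatives, the derivative along v of the left invariant field
    of u. *)
Lemma is_derive_Ad u v :
  is_derive (0 : R) (1 : R) (fun s : R => Ad G (s *: u) v) (lie_bracket m u v).
Proof.
pose psi := fun s : R => Ad G (s *: u) v.
have [p dpsi] : exists p, is_derive (0 : R) (1 : R) psi p.
  eexists; apply: is_derive_gmul; last by apply: is_deriveN; exact: is_derive_ray.
  by apply: is_derive_gmul; exact: is_derive_ray.
pose N w := fun z => 'D_w (fun x => m x z) 0.
have dN w : is_derive (0 : R) (1 : R) (fun s : R => N w (s *: u)) ('D_w (left_inv_field m u) 0).
  have [_ ->] := is_derive_left_inv_field u w 0.
  rewrite [X in is_derive _ _ _ X](schwarz _ _ _ (@gmul_smooth _ _ G)).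
  have := is_derive_chain
    (is_derive_pair (is_derive_cst (0 : V) (0 : R) (1 : R)) (is_derive_ray u (0 : R)))
    (differentiable_partial_gmul (0, 0 *: u) (w, 0)).
  by rewrite scale0r; apply: is_derive_ext => s; rewrite /N drE.
have NE w s : N w (s *: u) = \sum_j w 0 j *: N (delta_mx 0 j) (s *: u).
  rewrite /N derive_sum_basis //.
  apply: (@differentiable_comp _ _ _ _ (fun z => (z, s *: u)) M); last exact: differentiable_gmul.
  exact: differentiable_pair.
have N0 w : N w 0 = w.
  by rewrite /N (_ : (fun z => m z 0) = id) ?derive_id //; apply/funext => z; exact: gmulx0.
have psi0 : psi 0 = v by rewrite /psi scale0r Ad0.
(* N is linear in its first argument; expanding along the basis makes this a
   product rule, in which psi s - v vanishes at s = 0. *)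
have dD : is_derive (0 : R) (1 : R) (fun s : R => N (psi s) (s *: u) - N v (s *: u)) p.
  apply: is_derive_row => k.
  have E s : (N (psi s) (s *: u) - N v (s *: u)) 0 k =
      \sum_j (psi s 0 j - v 0 j) * N (delta_mx 0 j) (s *: u) 0 k.
    rewrite NE (NE v) -sumrB !summxE; apply: eq_bigr => j _.
    by rewrite -scalerBl mxE.
  have pE : p 0 k = \sum_j ((psi 0 0 j - v 0 j) * ('D_(delta_mx 0 j) (left_inv_field m u) 0) 0 k
       + N (delta_mx 0 j) (0 *: u) 0 k * (p 0 j - 0)).
    rewrite {1}[p]row_sum_delta summxE; apply: eq_bigr => j _.
    by rewrite psi0 subrr mul0r add0r subr0 scale0r N0 mxE mulrC.
  rewrite pE.
  have := @is_derive_sum R _ _ n (fun j s => (psi s 0 j - v 0 j) * N (delta_mx 0 j) (s *: u) 0 k)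
     (0 : R) (1 : R) _
     (fun j => is_deriveM
       (is_deriveB (is_derive_coord j dpsi) (is_derive_cst (v 0 j) (0 : R) (1 : R)))
       (is_derive_coord k (dN (delta_mx 0 j)))).
  by apply: is_derive_ext => s; rewrite E fct_sumE.
have dL : is_derive (0 : R) (1 : R) (fun s : R => left_inv_field m v (s *: u))
    ('D_u (left_inv_field m v) 0).
  have dv := differentiable_left_inv_field v (0 + (0:R) *: u).
  have := is_derive_along (@diff_derivable _ _ _ _ _ u dv).
  rewrite scale0r addr0.
  by apply: is_derive_ext => s; rewrite add0r.
have dL2 : is_derive (0 : R) (1 : R) (fun s : R => left_inv_field m v (s *: u))
    (p + 'D_v (left_inv_field m u) 0).
  have := is_deriveD dD (dN v).
  apply: is_derive_ext => s /=.
  by rewrite [LHS]subrK /left_inv_field dl_Ad.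
by rewrite /lie_bracket (is_derive_unique dL dL2) addrK.
Qed.

Lemma lie_bracketC u v : lie_bracket m u v = - lie_bracket m v u.
Proof. by rewrite /lie_bracket opprB. Qed.

Lemma lie_bracketPr c u v w :
  lie_bracket m u (c *: v + w) = c *: lie_bracket m u v + lie_bracket m u w.
Proof.
apply: (is_derive_unique (is_derive_Ad u (c *: v + w))).
have := is_deriveD (is_deriveZ c (is_derive_Ad u v)) (is_derive_Ad u w).
by apply: is_derive_ext => s; rewrite AdP.
Qed.

Lemma lie_bracket_sumr u v :
  lie_bracket m u v = \sum_j v 0 j *: lie_bracket m u (delta_mx 0 j).
Proof. by apply: linear_row_sum => c w w'; exact: lie_bracketPr. Qed.

Lemma lie_bracket_coord u v k : (lie_bracket m u v) 0 k =
  \sum_j \sum_i u 0 i * v 0 j * (lie_bracket m (delta_mx 0 i) (delta_mx 0 j)) 0 k.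
Proof.
rewrite lie_bracket_sumr summxE; apply: eq_bigr => j _.
rewrite mxE lie_bracketC lie_bracket_sumr -sumrN summxE mulr_sumr.
apply: eq_bigr => i _; rewrite [in RHS]lie_bracketC.
by move: (lie_bracket _ _ _) => w; rewrite !mxE; ring.
Qed.

Lemma lie_bracket_basis i j k : gdeg G k != (gdeg G i + gdeg G j)%N ->
  (lie_bracket m (delta_mx 0 i) (delta_mx 0 j)) 0 k = 0.
Proof.
apply: gbracket_grading; try exact: gdeg_gt0.
  by move=> l; rewrite mxE eqxx /=; case: (eqVneq l i) => // ->; rewrite eqxx.
by move=> l; rewrite mxE eqxx /=; case: (eqVneq l j) => // ->; rewrite eqxx.
Qed.

Lemma dilationE r x j : dil r x 0 j = r ^+ gdeg G j * x 0 j.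
Proof. by rewrite mxE. Qed.

Lemma dilationP r c x y : dil r (c *: x + y) = c *: dil r x + dil r y.
Proof. by apply/rowP => j; rewrite !mxE mulrDr mulrCA. Qed.

Lemma dilationZ r c x : dil r (c *: x) = c *: dil r x.
Proof. by apply/rowP => j; rewrite !mxE mulrCA. Qed.

Lemma dilation1 x : dil 1 x = x.
Proof. by apply/rowP => j; rewrite !mxE expr1n mul1r. Qed.

Lemma dilationM r s x : dil r (dil s x) = dil (r * s) x.
Proof. by apply/rowP => j; rewrite !mxE exprMn mulrA. Qed.

Lemma dilationK r x : r != 0 -> dil r (dil r^-1 x) = x.
Proof. by move=> r0; rewrite dilationM divff // dilation1. Qed.

Lemma dilationx0 r : dil r 0 = 0.
Proof. by apply/rowP => j; rewrite !mxE mulr0. Qed.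

Lemma is_derive_dilation (T : normedModType R) (f : T -> V) (x v : T) (df : V) r :
  is_derive x v f df -> is_derive x v (fun p => dil r (f p)) (dil r df).
Proof.
move=> hf; apply: is_derive_row => j; rewrite mxE.
have := is_deriveZ (r ^+ gdeg G j) (is_derive_coord j hf).
by apply: is_derive_ext => p; rewrite [RHS]mxE.
Qed.

(** The bracket is bilinear and the bracket of basis vectors of degrees i and j
    has degree i + j. *)
Lemma lie_bracket_dilation r u v :
  lie_bracket m (dil r u) (dil r v) = dil r (lie_bracket m u v).
Proof.
have := lie_bracket_basis; have := lie_bracket_coord.
move: (lie_bracket m) => b bC bB; apply/rowP => k.
rewrite dilationE bC [in RHS]bC mulr_sumr; apply: eq_bigr => j _.
rewrite mulr_sumr; apply: eq_bigr => i _; rewrite !(dilationE _ u, dilationE _ v).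
have [->|e] := eqVneq (gdeg G k) (gdeg G i + gdeg G j)%N.
  by move: (b _ _) => w; rewrite exprD; ring.
by rewrite bB // !mulr0.
Qed.

(** Degrees are positive, so bracketing strictly raises the degree.  This
    nilpotency gives uniqueness for the linear equations E' = [y, E]. *)
Lemma lie_bracket_triangular u w k : (forall j, (gdeg G j < gdeg G k)%N -> w 0 j = 0) ->
  (lie_bracket m u w) 0 k = 0.
Proof.
move=> h; rewrite lie_bracket_coord big1 // => j _; rewrite big1 // => i _.
have [e|e] := eqVneq (gdeg G k) (gdeg G i + gdeg G j)%N.
  by rewrite h ?mulr0 ?mul0r // e -{1}[gdeg G j]add0n ltn_add2r gdeg_gt0.
by rewrite lie_bracket_basis // mulr0.
Qed.

Lemma is_derive_Ad_ray y v s :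
  is_derive s (1 : R) (fun s : R => Ad G (s *: y) v) (lie_bracket m y (Ad G (s *: y) v)).
Proof.
apply: is_derive_translate (is_derive_Ad y (Ad G (s *: y) v)) => h.
by rewrite -Ad_comp gmul_exp.
Qed.

(** Both sides, taken at s y instead of y, solve E' = [delta_r y, E] with the
    same value at s = 0.  Their difference W solves the same equation with
    W(0) = 0; the system is triangular, so by induction on the degree every
    coordinate of W has zero derivative. *)
Lemma Ad_dilation r y v : Ad G (dil r y) (dil r v) = dil r (Ad G y v).
Proof.
pose W := fun s : R => Ad G (s *: dil r y) (dil r v) - dil r (Ad G (s *: y) v).
have dW s : is_derive s (1 : R) W (lie_bracket m (dil r y) (W s)).
  rewrite /W addrC -scaleN1r lie_bracketPr addrC scaleN1r lie_bracket_dilation.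
  by apply: is_deriveB; [exact: is_derive_Ad_ray|apply/is_derive_dilation/is_derive_Ad_ray].
have W0 : W 0 = 0 by rewrite /W !scale0r !Ad0 subrr.
have WE K : forall s k, (gdeg G k < K)%N -> W s 0 k = 0.
  elim: K => // K IH s k hk.
  have d t : is_derive t (1 : R) (fun t => W t 0 k) 0.
    rewrite -(@lie_bracket_triangular (dil r y) (W t) k); first exact: is_derive_coord.
    by move=> j hj; apply: IH; exact: leq_trans hj _.
  by rewrite (is_derive_0_is_cst s 0 d) W0 mxE.
have : W 1 = 0 by apply/rowP => k; rewrite (WE (gdeg G k).+1) ?mxE.
by rewrite /W !scale1r => /eqP; rewrite subr_eq0 => /eqP.
Qed.

(** The Maurer-Cartan form, i.e. the tangent vector v at y translated to 0. *)
Definition maurer_cartan y v := dl m (- y) y v.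

(** Let w = y + e v, so that w depends on e.  Then
    ((s + t) y)^-1 ((s + t) w) = Ad(- s y)((t y)^-1 (t w)) . (s y)^-1 (s w);
    differentiate at e = 0, where both factors are 0 and the differential of the
    product is the sum. *)
Lemma maurer_cartan_cocycle s t y v : maurer_cartan ((s + t) *: y) ((s + t) *: v) =
  maurer_cartan (s *: y) (s *: v) + Ad G (- (s *: y)) (maurer_cartan (t *: y) (t *: v)).
Proof.
have line a : is_derive (0 : R) (1 : R) (fun e : R => m (- (a *: y)) (a *: (y + e *: v)))
     (maurer_cartan (a *: y) (a *: v)).
  have := is_derive_gmull G (- (a *: y)) (is_deriveZ a (is_derive_line y v (0 : R))).
  by rewrite /= scale0r addr0.
apply: (is_derive_unique (line (s + t))).
have h1 := line t.
have z0 a : m (- (a *: y)) (a *: (y + (0:R) *: v)) = 0 by rewrite scale0r addr0 gmulNx.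
have h2 := is_derive_chain h1 (differentiable_Ad G (- (s *: y)) _).
have := is_derive_gmul G h2 (line s).
rewrite /= !z0 Adx0 derive_gmul0 -Ad_derive0 addrC.
apply: is_derive_ext => e /=.
rewrite /Ad opprK -!gmulA gmulNKx.
have -> : (s + t) *: (y + e *: v) = m (t *: (y + e *: v)) (s *: (y + e *: v)).
  by rewrite gmul_exp addrC.
have -> : - ((s + t) *: y) = m (- (s *: y)) (- (t *: y)).
  by rewrite -!scaleNr gmul_exp opprD.
by rewrite !gmulA.
Qed.

Lemma maurer_cartan_continuous0 y v : maurer_cartan (h *: y) v @[h --> (0:R)] --> v.
Proof.
have -> : (fun h : R => maurer_cartan (h *: y) v) =
    (fun p => 'D_(0, v) M p) \o (fun h : R => (- (h *: y), h *: y)).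
  by apply/funext => h; rewrite /maurer_cartan dlE.
have dg := is_derive_pair (is_deriveN (is_derive_ray y (0 : R))) (is_derive_ray y (0 : R)).
have cg : {for 0, continuous (fun h : R => (- (h *: y), h *: y))}.
  by apply/differentiable_continuous/derivable1_diffP; have [] := dg.
have := continuous_comp cg (@continuous_partial_gmul (0, v) _).
by rewrite /prop_for /continuous_at /= scale0r oppr0 derive_gmul0 add0r.
Qed.

Lemma maurer_cartanZ c y v : maurer_cartan y (c *: v) = c *: maurer_cartan y v.
Proof. exact: dlZ. Qed.

(** The cocycle identity reduces the derivative at s to the derivative at 0,
    which is v because the form is the identity at 0 and is continuous. *)
Lemma is_derive_maurer_cartan y v s :
  is_derive s (1 : R) (fun s : R => maurer_cartan (s *: y) (s *: v)) (Ad G (- (s *: y)) v).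
Proof.
have d0 : is_derive (0 : R) (1 : R) (fun s : R => maurer_cartan (s *: y) (s *: v)) v.
  have c : h^-1 *: (((fun s : R => maurer_cartan (s *: y) (s *: v)) \o shift 0) (h *: 1) -
      maurer_cartan (0 *: y) (0 *: v)) @[h --> 0^'] --> v.
    apply: (@cvg_trans _ (maurer_cartan (h *: y) v @[h --> (0:R)^'])); last first.
      by apply: cvg_within_filter; exact: maurer_cartan_continuous0.
    apply: near_eq_cvg; near=> h.
    rewrite /= addr0 [h *: 1]mulr1 !maurer_cartanZ scale0r subr0 scalerA mulVf ?scale1r //.
    by near: h; exact: nbhs_dnbhs_neq.
  by split; [apply/cvg_ex; exists v|exact: cvg_lim].
have h2 := is_derive_chain d0 (differentiable_Ad G (- (s *: y)) _).
have := is_deriveD (is_derive_cst (maurer_cartan (s *: y) (s *: v)) (0 : R) (1 : R)) h2.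
rewrite add0r /= !scale0r {3}/maurer_cartan dlx0 -Ad_derive0.
apply: is_derive_translate => h.
by rewrite addrC maurer_cartan_cocycle.
Unshelve. all: by end_near. Qed.

Lemma maurer_cartan_dilation r y v : maurer_cartan (dil r y) (dil r v) = dil r (maurer_cartan y v).
Proof.
have e : (fun s : R => maurer_cartan (s *: dil r y) (s *: dil r v)) =1
    (fun s => dil r (maurer_cartan (s *: y) (s *: v))).
  apply: (derive_ext_row (df := fun s => Ad G (- (s *: dil r y)) (dil r v))).
  - by move=> s; exact: is_derive_maurer_cartan.
  - move=> s; have -> : - (s *: dil r y) = dil r (- (s *: y)) by rewrite -!scaleNr dilationZ.
    by rewrite Ad_dilation; apply/is_derive_dilation/is_derive_maurer_cartan.
  - by rewrite !scale0r /maurer_cartan !dlx0 dilationx0.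
by have := e 1; rewrite !scale1r.
Qed.

(** The left invariant field inverts the Maurer-Cartan form. *)
Lemma left_inv_field_dilation r y v :
  left_inv_field m (dil r v) (dil r y) = dil r (left_inv_field m v y).
Proof.
have := maurer_cartan_dilation r y (left_inv_field m v y).
rewrite {2}/maurer_cartan /left_inv_field dlK => <-.
by rewrite /maurer_cartan dlNK.
Qed.

(** The one-parameter subgroup of v is the ray s |-> s v, so its velocity is
    constant. *)
Lemma left_inv_field_ray s v : left_inv_field m v (s *: v) = v.
Proof.
have h1 : is_derive (0 : R) (1 : R) (fun t : R => m (s *: v) (t *: v))
    (left_inv_field m v (s *: v)).
  by have := is_derive_gmull G (s *: v) (is_derive_ray v (0 : R)); rewrite scale0r.
apply: (is_derive_unique h1).
apply: is_derive_ext (is_derive_line (s *: v) v (0 : R)) => t.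
by rewrite gmul_exp scalerDl.
Qed.

Lemma continuous_left_inv_field v : continuous (left_inv_field m v).
Proof. by move=> x; exact/differentiable_continuous/differentiable_left_inv_field. Qed.

Lemma left_inv_field_sum v y :
  left_inv_field m v y = \sum_j v 0 j *: left_inv_field m (delta_mx 0 j) y.
Proof. by apply: (linear_row_sum (f := fun v => dl m y 0 v)) => c u w; exact: dlP. Qed.

Lemma left_inv_field_homogeneous r y j k :
  r ^+ gdeg G j * (left_inv_field m (delta_mx 0 j) (dil r y)) 0 k =
  r ^+ gdeg G k * (left_inv_field m (delta_mx 0 j) y) 0 k.
Proof.
rewrite -[RHS]dilationE -left_inv_field_dilation.
have -> : dil r (delta_mx 0 j) = r ^+ gdeg G j *: delta_mx 0 j.
  apply/rowP => l; rewrite !mxE eqxx /=; case: eqVneq => [->|]; rewrite ?mulr1 ?mulr0 //.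
by rewrite /left_inv_field dlZ [in RHS]mxE.
Qed.

(** Homogeneity forces the k-coordinate of the field of e_j to be a polynomial
    of weighted degree deg k - deg j, in which a variable of degree at least
    deg k cannot occur.  Directly: the partial derivative at y equals
    r^(deg j + deg i - deg k) times the one at delta_r y, the exponent is
    positive, and the latter stays bounded as r tends to 0. *)
Lemma derive_left_inv_field_high_coord i j k y : (gdeg G k <= gdeg G i)%N ->
  ('D_(delta_mx 0 i) (left_inv_field m (delta_mx 0 j)) y) 0 k = 0.
Proof.
move=> ki; set X := left_inv_field m (delta_mx 0 j).
set e := delta_mx 0 i.
have H r : r != 0 ->
  r ^+ (gdeg G j + (gdeg G i - gdeg G k)) * ('D_e X (dil r y)) 0 k = ('D_e X y) 0 k.
  move=> r0.
  have h1 : is_derive (0 : R) (1 : R) (fun t : R => r ^+ gdeg G k * X (y + t *: e) 0 k)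
       (r ^+ gdeg G k * 'D_e X y 0 k).
    have dXy := differentiable_left_inv_field (delta_mx 0 j) (y + (0:R) *: e).
    have := is_derive_along (@diff_derivable _ _ _ _ _ e dXy).
    by rewrite scale0r addr0 => /(is_derive_coord k)/(is_deriveZ (r ^+ gdeg G k)).
  have h2 : is_derive (0 : R) (1 : R)
       (fun t : R => r ^+ gdeg G j * X (dil r y + t *: (r ^+ gdeg G i *: e)) 0 k)
       (r ^+ gdeg G j * (r ^+ gdeg G i * 'D_e X (dil r y) 0 k)).
    have dXr := differentiable_left_inv_field (delta_mx 0 j) (dil r y).
    have := is_derive_along (x := dil r y) (t := (0 : R)) (v := r ^+ gdeg G i *: e) (f := X).
    rewrite scale0r addr0 => /(_ (@diff_derivable _ _ _ _ _ _ dXr)).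
    move=> /(is_derive_coord k)/(is_deriveZ (r ^+ gdeg G j)).
    have -> : 'D_(r ^+ gdeg G i *: e) X (dil r y) = r ^+ gdeg G i *: 'D_e X (dil r y).
      by have := derive_linear (r ^+ gdeg G i) e 0 dXr; rewrite derive0 !addr0.
    by rewrite mxE.
  have E : r ^+ gdeg G j * (r ^+ gdeg G i * 'D_e X (dil r y) 0 k) = r ^+ gdeg G k * 'D_e X y 0 k.
    have pt t : r ^+ gdeg G k * X (y + t *: e) 0 k =
        r ^+ gdeg G j * X (dil r y + t *: (r ^+ gdeg G i *: e)) 0 k.
      rewrite -left_inv_field_homogeneous.
      suff -> : dil r (y + t *: e) = dil r y + t *: (r ^+ gdeg G i *: e) by [].
      rewrite addrC dilationP addrC; congr (_ + _ *: _).
      by apply/rowP => l; rewrite !mxE eqxx /=; case: (eqVneq l i) => [->|]; rewrite ?mulr1 ?mulr0.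
    exact: (is_derive_unique h2 (is_derive_ext pt h1)).
  have rk : r ^+ gdeg G k != 0 by rewrite expf_neq0.
  apply: (mulfI rk); rewrite -E !mulrA -!exprD; congr (_ ^+ _ * _).
  by rewrite addnCA subnKC.
have cD : continuous ('D_e X).
  move=> z; have -> : 'D_e X = (fun z => 'D_(e, 0) (fun p => 'D_(0, delta_mx 0 j) M p) (z, 0)).
    by apply/funext => z'; have [_ <-] := is_derive_left_inv_field (delta_mx 0 j) e z'.
  have sm := @smooth_derive _ _ _ _ (e, 0)
    (@smooth_derive _ _ _ _ (0, delta_mx 0 j) (@gmul_smooth _ _ G)).
  have cp : {for z, continuous (fun z : V => (z, 0 : V))}.
    by apply: differentiable_continuous; exact: differentiable_pair.
  have cs : {for (z, 0), continuous ('D_(e, 0) ('D_(0, delta_mx 0 j) M))}.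
    exact: smooth_continuous sm _.
  exact: (continuous_comp cp cs).
have c1 : r ^+ (gdeg G j + (gdeg G i - gdeg G k)) * ('D_e X (dil r y)) 0 k @[r --> (0:R)^'] -->
   (0:R) ^+ (gdeg G j + (gdeg G i - gdeg G k)) * ('D_e X (dil 0 y)) 0 k.
  apply: cvg_within_filter; apply: cvgM; first exact: exprn_continuous.
  have cd : dil r y @[r --> (0:R)] --> dil 0 y.
    apply: cvg_row => l; rewrite dilationE; under eq_fun do rewrite dilationE.
    by apply: cvgM; [exact: exprn_continuous | exact: cvg_cst].
  apply: cvg_coord; exact: (@continuous_cvg _ _ _ _ _ (fun r => dil r y) ('D_e X) _ (cD _) cd).
have c2 : r ^+ (gdeg G j + (gdeg G i - gdeg G k)) * ('D_e X (dil r y)) 0 k @[r --> (0:R)^'] -->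
   ('D_e X y) 0 k.
  apply: (@cvg_trans _ (('D_e X y) 0 k @[_ --> (0:R)^'])); last exact: cvg_cst.
  apply: near_eq_cvg; near=> r.
  by rewrite H //; near: r; exact: nbhs_dnbhs_neq.
have := cvg_unique _ c2 c1; rewrite -/e -/X => ->.
have /prednK <- := gdeg_gt0 G j.
by rewrite addSn expr0n /= mul0r.
Unshelve. all: by end_near. Qed.

(** What makes the induction on the degree in [curve_blowup] possible: the
    k-coordinate of a left invariant field is determined by the coordinates of
    degree less than deg k. *)
Lemma left_inv_field_low_coords j k y z : (forall i, (gdeg G i < gdeg G k)%N -> y 0 i = z 0 i) ->
  left_inv_field m (delta_mx 0 j) y 0 k = left_inv_field m (delta_mx 0 j) z 0 k.
Proof.
move=> yz.
have d t : is_derive t (1 : R)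
    (fun t : R => left_inv_field m (delta_mx 0 j) (z + t *: (y - z)) 0 k) 0.
  have dXz := differentiable_left_inv_field (delta_mx 0 j) (z + t *: (y - z)).
  have := is_derive_along (@diff_derivable _ _ _ _ _ (y - z) dXz).
  move=> /(is_derive_coord k).
  rewrite derive_sum_basis // summxE big1 //.
  move=> i _; rewrite mxE; case: (ltnP (gdeg G i) (gdeg G k)) => ik.
    by rewrite !mxE yz // subrr mul0r.
  by rewrite derive_left_inv_field_high_coord // mulr0.
have := is_derive_0_is_cst 1 0 d.
by rewrite scale1r scale0r addr0 addrC subrK.
Qed.

End Bracket.

(** * Blow-up of a curve of degree q *)

Section Blowup.
Context (R : realType) (n : nat) (G : gradedGroup R n).
Local Notation V := 'rV[R]_n.
Local Notation m := (gmul G).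
Local Notation dil := (dilation G).
Local Notation deg := (gdeg G).

(** The parameter is written r^q, so that the dilation of ratio 1/r is the
    natural scaling: the coordinates of y(r^q) in degree k are of order at most r^k. *)
Lemma curve_blowup (q : nat) (y lam : R -> V) : (0 < q)%N -> y 0 = 0 ->
  (\forall u \near (0 : R), is_derive u (1 : R) y (left_inv_field m (lam u) (y u))) ->
  (\forall u \near (0 : R), forall j, (q < deg j)%N -> lam u 0 j = 0) ->
  {for 0, continuous lam} ->
  dil r^-1 (y (r ^+ q)) @[r --> (0:R)^'+] --> proj_layer G q (lam 0).
Proof.
move=> q0 y0 dy lamq clam.
set c := proj_layer G q (lam 0).
pose X j k z : R := left_inv_field m (delta_mx 0 j) z 0 k.
have pow0 : r ^+ q @[r --> (0:R)^'+] --> (0:R).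
  apply: cvg_at_right_filter; have := @exprn_continuous R q 0.
  by rewrite /continuous_at expr0n gtn_eqF.
have clamr j : lam (r ^+ q) 0 j @[r --> (0:R)^'+] --> lam 0 0 j.
  by apply: cvg_coord; exact: (@cvg_comp _ _ _ (fun r => r ^+ q) lam _ _ _ pow0 clam).
(* Degree at most q: y_k(r^q) / r^q tends to lam_k(0), and the remaining factor
   r^(q - deg k) tends to 0 unless deg k = q. *)
have lowdeg k : (deg k <= q)%N -> dil r^-1 (y (r ^+ q)) 0 k @[r --> (0:R)^'+] --> c 0 k.
  move=> kq.
  have d0 : is_derive (0 : R) (1 : R) (fun u => y u 0 k) (lam 0 0 k).
    have := is_derive_coord k (nbhs_singleton dy).
    by rewrite y0 /left_inv_field dl_id.
  have pow0' : r ^+ q @[r --> (0:R)^'+] --> (0:R)^'.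
    move=> A /= [e e0 eA].
    have := pow0 _ (nbhsx_ballx _ _ e0); rewrite /= => h.
    rewrite /nbhs /=; near=> r; apply: eA; first by near: r; exact: h.
    by rewrite expf_neq0 // gt_eqF //; near: r; exact: nbhs_right_gt.
  have slope : h^-1 * y h 0 k @[h --> (0:R)^'] --> lam 0 0 k.
    have [d0d <-] := d0; apply: cvg_trans d0d; apply: near_eq_cvg; near=> h.
    by rewrite /= y0 mxE subr0 addr0 [h *: 1]mulr1.
  have slopeq : (r ^+ q)^-1 * y (r ^+ q) 0 k @[r --> (0:R)^'+] --> lam 0 0 k.
    exact: (@cvg_comp _ _ _ (fun r => r ^+ q) (fun h => h^-1 * y h 0 k) _ _ _ pow0' slope).
  have powd : r ^+ (q - deg k) @[r --> (0:R)^'+] --> (0:R) ^+ (q - deg k).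
    by apply: cvg_at_right_filter; exact: exprn_continuous.
  have cE : c 0 k = 0 ^+ (q - deg k) * lam 0 0 k.
    rewrite mxE expr0n subn_eq0; case: eqVneq => [->|ne]; first by rewrite leqnn mul1r.
    by rewrite leqNgt ltn_neqAle ne kq mul0r.
  rewrite cE; apply: cvg_trans (cvgM powd slopeq); apply: near_eq_cvg; near=> r.
  have r0 : r != 0 by rewrite gt_eqF //; near: r; exact: nbhs_right_gt.
  rewrite dilationE; apply: (etrans (mulrA _ _ _)); congr (_ * _).
  by rewrite -{2}(subnK kq) exprD invfM mulrA divff ?mul1r ?exprVn // expf_neq0.
have all_deg K : forall k, (deg k < K)%N -> dil r^-1 (y (r ^+ q)) 0 k @[r --> (0:R)^'+] --> c 0 k.
  elim: K => // K IH k hk.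
  have [kq|qk] := leqP (deg k) q; first exact: lowdeg.
  (* Z is the rescaled point with the coordinates of degree at least deg k set to
     0: the induction hypothesis controls the others, and the k-coordinate of the
     fields only sees those. *)
  pose Z r : V := \row_i (if (deg i < deg k)%N then dil r^-1 (y (r ^+ q)) 0 i else 0).
  pose c' : V := \row_i (if (deg i < deg k)%N then c 0 i else 0).
  have ZE r i : Z r 0 i = if (deg i < deg k)%N then dil r^-1 (y (r ^+ q)) 0 i else 0 by rewrite mxE.
  have cZ : Z r @[r --> (0:R)^'+] --> c'.
    apply: cvg_row => i; under eq_fun do rewrite ZE.
    rewrite [c' 0 i]mxE; case: ifP => ik; last exact: cvg_cst.
    by apply: IH; exact: leq_trans ik _.
  (* r^(deg k - q) T(r) is the k-coordinate of the velocity at r^q. *)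
  pose Tj j r :=
    if (deg j <= q)%N then lam (r ^+ q) 0 j * r ^+ (q - deg j) * X j k (Z r) else 0.
  pose T r := \sum_j Tj j r.
  have cT : T r @[r --> (0:R)^'+] --> (0:R).
    (* In the limit the factor 0^(q - deg j) keeps only deg j = q, and what remains
       is the k-coordinate of the field of c at c, which is c_k = 0. *)
    have T0 : \sum_j (if (deg j <= q)%N then lam 0 0 j * 0 ^+ (q - deg j) * X j k c' else 0) = 0.
      apply/esym; transitivity ((left_inv_field m c c) 0 k).
        by have := left_inv_field_ray G 1 c; rewrite scale1r => ->; rewrite mxE gtn_eqF.
      rewrite left_inv_field_sum summxE; apply: eq_bigr => j _.
      rewrite mxE {1}/c mxE expr0n subn_eq0.
      have -> : X j k c' = left_inv_field m (delta_mx 0 j) c 0 k.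
        by apply: left_inv_field_low_coords => i ik; rewrite mxE ik.
      case: eqVneq => [->|ne]; first by rewrite leqnn mulr1.
      case: ifP => jq; last by rewrite mul0r.
      by rewrite leqNgt ltn_neqAle ne jq mulr0 !mul0r.
    have cTj j : Tj j r @[r --> (0:R)^'+] -->
        (if (deg j <= q)%N then lam 0 0 j * 0 ^+ (q - deg j) * X j k c' else 0).
      have cX := @continuous_left_inv_field R n G (delta_mx 0 j) c'.
      have cXZ : left_inv_field m (delta_mx 0 j) (Z r) @[r --> (0:R)^'+] -->
          left_inv_field m (delta_mx 0 j) c'.
        exact: (cvg_comp _ _ cZ cX).
      have cXk : X j k (Z r) @[r --> (0:R)^'+] --> X j k c' by exact: cvg_coord cXZ.
      have cr : r ^+ (q - deg j) @[r --> (0:R)^'+] --> (0:R) ^+ (q - deg j).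
        by apply: cvg_at_right_filter; exact: exprn_continuous.
      rewrite /Tj; case: (deg j <= q)%N; first exact: (cvgM (cvgM (clamr j) cr) cXk).
      exact: cvg_cst.
    rewrite -[X in _ --> X]T0.
    apply: (@cvg_big _ _ _ _ xpredT _ _ _ _ Tj) => [|j _]; [exact: add_continuous|exact: cTj].
  have gT : \forall r \near (0:R)^'+,
      left_inv_field m (lam (r ^+ q)) (y (r ^+ q)) 0 k = r ^+ (deg k - q) * T r.
    near=> r.
    have r0 : r != 0 by rewrite gt_eqF //; near: r; exact: nbhs_right_gt.
    rewrite left_inv_field_sum summxE mulr_sumr; apply: eq_bigr => j _; rewrite mxE /Tj.
    case: leqP => jq; last first.
      suff -> : lam (r ^+ q) 0 j = 0 by rewrite mul0r mulr0.
      by move: j jq; near: r; exact: (pow0 _ lamq).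
    have XE : X j k (Z r) = X j k (dil r^-1 (y (r ^+ q))).
      by apply: left_inv_field_low_coords => i ik; rewrite ZE ik.
    have hX : r ^+ deg j * X j k (y (r ^+ q)) = r ^+ deg k * X j k (dil r^-1 (y (r ^+ q))).
      by rewrite /X -left_inv_field_homogeneous dilationK.
    have rj : r ^+ deg j != 0 by rewrite expf_neq0.
    rewrite XE -/(X j k (y (r ^+ q))).
    move: (X j k _) (X j k _) hX => a b hX; apply: (mulfI rj).
    have e : r ^+ deg k = r ^+ (deg k - q) * r ^+ (q - deg j) * r ^+ deg j.
      by rewrite -!exprD -addnA subnK // subnK // ltnW.
    by rewrite mulrCA hX e; ring.
  have : dil r^-1 (y (r ^+ q)) 0 k @[r --> (0:R)^'+] --> (0:R).
    apply/cvgrPdist_le => e e0.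
    have qe0 : 0 < e / q%:R by rewrite divr_gt0 // ltr0n.
    have [d1 /= d10 hd1] := (cvgrPdist_le _ _).1 cT _ qe0.
    have [d2 /= d20 hd2] := gT.
    have [d3 /= d30 hd3] := dy.
    near=> r.
    have r0 : 0 < r by near: r; exact: nbhs_right_gt.
    have r1 : r < 1 by near: r; exact: nbhs_right_lt.
    have rd1 : r < d1 by near: r; exact: nbhs_right_lt.
    have rd2 : r < d2 by near: r; exact: nbhs_right_lt.
    have rd3 : r < d3 by near: r; exact: nbhs_right_lt.
    have dY s : 0 <= s <= r -> is_derive s (1 : R) (fun s => y (s ^+ q) 0 k)
       (q%:R * s ^+ q.-1 * left_inv_field m (lam (s ^+ q)) (y (s ^+ q)) 0 k).
      move=> /andP[s0 sr].
      have sq : s ^+ q <= s by apply: ler_iXnr => //; exact: le_trans sr (ltW r1).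
      have dys : is_derive (s ^+ q) (1 : R) y (left_inv_field m (lam (s ^+ q)) (y (s ^+ q))).
        apply: hd3; rewrite /ball /= sub0r normrN ger0_norm ?exprn_ge0 //.
        by rewrite (le_lt_trans sq) // (le_lt_trans sr).
      have dsq : is_derive s (1 : R) (fun s : R => s ^+ q) (q%:R * s ^+ q.-1).
        by split; [exact: exprn_derivable | rewrite exp_derive [_%:A]mulr1].
      by have := is_derive_coord k (is_derive_comp1 dsq dys); rewrite mxE.
    have dY' s : s \in `]0, r[%R -> is_derive s (1 : R) (fun s => y (s ^+ q) 0 k)
       (q%:R * s ^+ q.-1 * left_inv_field m (lam (s ^+ q)) (y (s ^+ q)) 0 k).
      by rewrite in_itv /= => /andP[a b]; apply: dY; rewrite !ltW.
    have cY : {within `[0, r], continuous (fun s => y (s ^+ q) 0 k)}.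
      apply: derivable_within_continuous => s; rewrite in_itv /= => hs.
      by have [] := dY s hs.
    (* Mean value theorem for s |-> y_k(s^q): the derivative is
       q s^(deg k - 1) T(s), and T is small. *)
    have [s] := MVT r0 dY' cY.
    rewrite in_itv /= => /andP[s0 sr].
    rewrite -[in y (0 ^+ q)](prednK q0) exprS mul0r y0 mxE !subr0 => yE.
    rewrite sub0r normrN dilationE yE.
    have s2 : ball 0 d2 s by rewrite /ball /= sub0r normrN gtr0_norm // (lt_trans sr).
    have s1 : ball 0 d1 s by rewrite /ball /= sub0r normrN gtr0_norm // (lt_trans sr).
    rewrite hd2 //.
    have := hd1 s s1 s0; rewrite sub0r normrN ler_pdivlMr ?ltr0n // => Te.
    have rk : 0 < r ^+ deg k by rewrite exprn_gt0.
    rewrite exprVn normrM normfV (gtr0_norm rk) ler_pdivrMl //.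
    rewrite !normrM (gtr0_norm r0) normr_nat !(gtr0_norm (exprn_gt0 _ s0)).
    have kE : (q.-1 + (deg k - q) + 1)%N = deg k.
      by rewrite addn1 -addSn prednK // subnKC // ltnW.
    have sk : s ^+ q.-1 * s ^+ (deg k - q) * r <= r ^+ deg k.
      rewrite -[in leRHS]kE exprD expr1 ler_pM2r // -exprD.
      by rewrite lerXn2r // ?nnegrE ltW.
    rewrite (_ : _ * r = (s ^+ q.-1 * s ^+ (deg k - q) * r) * (`|T s| * q%:R)); last by ring.
    by apply: ler_pM => //; rewrite !mulr_ge0 ?exprn_ge0 ?ltW.
  by rewrite mxE gtn_eqF.
apply: cvg_row => k; exact: (all_deg (deg k).+1).
Unshelve. all: by end_near. Qed.

End Blowup.

(** * Hausdorff measure of a segment *)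

Section SegmentLength.
Context (R : realType) (n : nat).
Local Notation V := 'rV[R]_n.
Implicit Types (u v w : V).

Lemma enormZ (c : R) v : enorm (c *: v) = `|c| * enorm v.
Proof.
rewrite /enorm (eq_bigr (fun j => c ^+ 2 * v 0 j ^+ 2)); last by move=> j _; rewrite mxE exprMn.
by rewrite -mulr_sumr sqrtrM ?sqr_ge0 // sqrtr_sqr.
Qed.

Lemma enorm_gt0 v : v != 0 -> 0 < enorm v.
Proof.
move=> v0; rewrite sqrtr_gt0 lt0r sumr_ge0 ?andbT; last by move=> j _; exact: sqr_ge0.
apply: contraNneq v0 => /eqP; rewrite psumr_eq0; last by move=> j _; exact: sqr_ge0.
move=> /allP h; apply/eqP/rowP => j; rewrite mxE.
by have := h j (mem_index_enum j); rewrite sqrf_eq0 => /eqP.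
Qed.

Lemma ediam_ge0 (E : set V) : (0 <= ediam E)%E.
Proof. by apply: ereal_sup_ubound; left. Qed.

Lemma ediam_ge (E : set V) u w : E u -> E w -> ((enorm (u - w))%:E <= ediam E)%E.
Proof. by move=> Eu Ew; apply: ereal_sup_ubound; right; exists u, w. Qed.

Lemma ediam_le (E : set V) (a : R) : 0 <= a ->
  (forall u w, E u -> E w -> enorm (u - w) <= a) -> (ediam E <= a%:E)%E.
Proof.
move=> a0 h; apply/ereal_supP => _ [->|[u [w [Eu Ew ->]]]]; first by rewrite lee_fin.
by rewrite lee_fin h.
Qed.

(** Pull each covering set back to the parameter line: its trace lies in a closed
    interval of length diameter / |v|, and Lebesgue measure is countably
    subadditive. *)
Lemma segment_cover_ge v (rho : R) (F : nat -> set V) : 0 <= rho -> v != 0 ->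
  (forall c : R, `|c| < rho -> exists k, F k (c *: v)) ->
  (forall k, ediam (F k) < +oo)%E ->
  ((2 * rho * enorm v)%:E <= \sum_(0 <= k <oo) ediam (F k))%E.
Proof.
move=> rho0 v0 cov fin; have L0 := enorm_gt0 v0; set L := enorm v in L0 *.
pose e k := fine (ediam (F k)) / L.
have eE k : ediam (F k) = (L%:E * (e k)%:E)%E.
  rewrite -EFinM mulrC divfK ?gt_eqF // fineK // fin_real //.
  by rewrite fin (lt_le_trans _ (ediam_ge0 _)) ?ltNyr.
have e0 k : 0 <= e k by rewrite divr_ge0 ?(ltW L0) // fine_ge0 // ediam_ge0.
pose I k := [set c : R | F k (c *: v)].
have Idist k c c' : I k c -> I k c' -> c - c' <= e k.
  move=> h h'; have := ediam_ge h h'; rewrite -scalerBl enormZ eE -EFinM lee_fin mulrC ler_pM2l //.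
  exact/le_trans/ler_norm.
(* For an empty trace the infimum is 0 by convention; the interval then
   still has the right length. *)
pose J k := `[inf (I k), inf (I k) + e k]%classic.
have IJ k : I k `<=` J k.
  move=> c hc; have lb : has_lbound (I k).
    by exists (c - e k) => c' hc'; rewrite lerBlDr addrC -lerBlDr; exact: Idist.
  rewrite /J /= in_itv /=; apply/andP; split; first exact: ge_inf.
  rewrite -lerBlDr; apply: lb_le_inf; first by exists c.
  by move=> c' hc'; rewrite lerBlDr addrC -lerBlDr; exact: Idist.
have mJ k : measurable (J k : set R) by exact: measurable_itv.
have muJ k : lebesgue_measure (J k) = (e k)%:E.
  rewrite /J lebesgue_measure_itv /= lte_fin ltrDl.
  case: ltP => ek; first by rewrite -EFinB addrC addKr.
  by congr (_%:E); apply/eqP; rewrite eq_le ek e0.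
have sub : `](- rho), rho[%classic `<=` \bigcup_k J k.
  move=> c; rewrite /= in_itv /= -ltr_norml => /cov[k Fk]; exists k => //; exact: IJ.
have muI : lebesgue_measure (`](- rho), rho[%classic : set R) = (2 * rho)%:E.
  rewrite lebesgue_measure_itv /= lte_fin; case: ifPn => [_|].
    by rewrite -EFinB; congr (_%:E); lra.
  by rewrite -leNgt => hr; congr (_%:E); lra.
have h : ((2 * rho)%:E <= \sum_(0 <= k <oo) (e k)%:E)%E.
  rewrite -muI -(eq_eseriesr (fun k _ => muJ k)).
  by apply: measure_sigma_subadditive => //; exact: measurable_itv.
rewrite (eq_eseriesr (fun k _ => eE k)) nneseriesZl; last by move=> k _; rewrite lee_fin.
by rewrite mulrC EFinM lee_pmul2l ?lte_fin.
Qed.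

(** Cut the segment into N equal pieces, with N large enough for each to have
    diameter at most delta. *)
Lemma segment_cover_le v (rho delta : R) : 0 < rho -> v != 0 -> 0 < delta ->
  exists F : nat -> set V, [/\ forall c : R, `|c| < rho -> exists k, F k (c *: v),
    forall k, (ediam (F k) <= delta%:E)%E &
    (\sum_(0 <= k <oo) ediam (F k) <= (2 * rho * enorm v)%:E)%E].
Proof.
move=> rho0 v0 delta0; have L0 := enorm_gt0 v0; set L := enorm v in L0 *.
pose N := (Num.truncn (2 * rho * L / delta)).+1.
have N0 : (0:R) < N%:R by rewrite ltr0n.
pose s := 2 * rho / N%:R.
have s0 : 0 < s by rewrite divr_gt0 // mulr_gt0.
have sd : s * L <= delta.
  rewrite /s mulrAC ler_pdivrMr // -ler_pdivrMl // mulrC ltW //.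
  exact: truncnS_gt.
pose F k := if (k < N)%N
  then [set c *: v | c in `[- rho + s * k%:R, - rho + s * k.+1%:R]%classic] else set0.
have dF k : (ediam (F k) <= (if (k < N)%N then (s * L)%:E else 0))%E.
  rewrite /F; case: ifP => kN; last by apply: ediam_le.
  apply: ediam_le; first by rewrite mulr_ge0 // ltW.
  move=> _ _ [c hc <-] [c' hc' <-]; rewrite -scalerBl enormZ ler_pM2r //.
  move: hc hc'; rewrite /= !in_itv /= => /andP[h1 h2] /andP[h3 h4].
  rewrite -natr1 mulrDr mulr1 in h2 h4; rewrite ler_norml; apply/andP; split; lra.
exists F; split.
- move=> c; rewrite ltr_norml => /andP[c1 c2].
  have cs0 : 0 <= (c + rho) / s by rewrite divr_ge0 ?(ltW s0) //; lra.
  have /andP[t1 t2] := truncn_itv cs0.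
  rewrite ler_pdivlMr // in t1; rewrite ltr_pdivrMr // in t2.
  exists (Num.truncn ((c + rho) / s)); rewrite /F.
  have -> : (Num.truncn ((c + rho) / s) < N)%N.
    rewrite -(ltr_nat R); rewrite -(ltr_pM2r s0); apply: (le_lt_trans t1).
    rewrite /s mulrC divfK ?gt_eqF //; lra.
  by exists c => //; rewrite /= in_itv /=; apply/andP; split; lra.
- move=> k; apply: (le_trans (dF k)); case: ifP => _; rewrite lee_fin //.
  exact: ltW.
- apply: (@le_trans _ _ (\sum_(0 <= k <oo) (if (k < N)%N then (s * L)%:E else 0))%E).
    by apply: lee_nneseries => [k _ _|k _]; [exact: ediam_ge0|exact: dF].
  rewrite (@nneseries_split _ _ 0%N N) ?add0n; last first.
    by move=> k _; case: ifP => _; rewrite lee_fin // mulr_ge0 // ltW.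
  rewrite [X in (_ + X)%E]eseries0 ?adde0; last by move=> k Nk _; rewrite ltnNge Nk.
  rewrite (eq_big_nat _ _ (F2 := fun=> (s * L)%:E)); last by move=> k /andP[_ ->].
  rewrite sumEFin lee_fin sumr_const_nat subn0 -[(s * L) *+ N]mulr_natr /s.
  by rewrite mulrAC divfK ?gt_eqF.
Qed.

Lemma hausdorff1_segment v (rho : R) (A : set V) : 0 < rho -> v != 0 ->
  A = [set c *: v | c in [set c : R | `|c| < rho]] ->
  hausdorff1 A = (2 * rho * enorm v)%:E.
Proof.
move=> rho0 v0 ->.
have E delta : 0 < delta ->
    hausdorff1_delta delta [set c *: v | c in [set c : R | `|c| < rho]] = (2 * rho * enorm v)%:E.
  move=> delta0; apply/eqP; rewrite eq_le; apply/andP; split.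
    have [F [F1 F2 F3]] := segment_cover_le rho0 v0 delta0.
    apply: (le_trans _ F3); apply: ereal_inf_lbound; exists F => //; split => //.
    by move=> _ [c hc <-]; have [k hk] := F1 c hc; exists k.
  apply/ereal_infP => _ [F [Fc Fd] <-]; apply: segment_cover_ge => //; first exact: ltW.
    move=> c hc; have [|k _ hk] := Fc (c *: v); first by exists c.
    by exists k.
  by move=> k; apply: (le_lt_trans (Fd k)); rewrite ltry.
rewrite /hausdorff1; apply/eqP; rewrite eq_le; apply/andP; split.
  by apply/ereal_supP => _ [delta delta0 <-]; rewrite E.
by apply: ereal_sup_ubound; exists 1; [exact: ltr01|rewrite E].
Qed.

End SegmentLength.

(** * Homogeneous distances *)

Section HomogeneousDistance.
Context (R : realType) (n : nat) (G : gradedGroup R n).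
Context (d : 'rV[R]_n -> 'rV[R]_n -> R) (hd : homogeneous_distance G d).
Local Notation V := 'rV[R]_n.
Local Notation m := (gmul G).
Local Notation dil := (dilation G).
Implicit Types (x y z u v w : V).

Lemma hdist_ge0 x y : 0 <= d x y.
Proof. by have [[h _] _ _ _ _] := hd; exact: h. Qed.

Lemma hdist_refl x : d x x = 0.
Proof. by have [[_ h] _ _ _ _] := hd; apply/h. Qed.

Lemma hdist_gt0 v : v != 0 -> 0 < d 0 v.
Proof.
move=> v0; rewrite lt0r hdist_ge0 andbT; apply: contraNneq v0 => h.
by have [[_ /(_ 0 v)[/(_ h) <-]]] := hd.
Qed.

Lemma hdist_dilation (r : R) v : 0 < r -> d 0 (dil r v) = r * d 0 v.
Proof. by move=> r0; have [_ _ _ _ /(_ r 0 v r0)] := hd; rewrite dilationx0. Qed.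

Lemma hdist_left x y : d x y = d 0 (m (- x) y).
Proof. by have [_ _ _ /(_ x y (- x)) + _] := hd; rewrite gmulNx. Qed.

Lemma hdist_opp v : d 0 (- v) = d 0 v.
Proof. by have [_ [h _] _ _ _] := hd; rewrite -[- v](gmulx0 G) -hdist_left h. Qed.

Lemma continuous_hdist x : continuous (d x).
Proof.
move=> y; have [_ _ cd _ _] := hd.
have cp : {for y, continuous (fun y => (x, y))}.
  by apply: differentiable_continuous; exact: differentiable_pair.
exact: (continuous_comp cp (cd (x, y))).
Qed.

Lemma root_exists (q : nat) (s : R) : (0 < q)%N -> 0 < s -> exists2 r, 0 < r & r ^+ q = s.
Proof.
move=> q0 s0; exists (s `^ (q%:R^-1)); first exact: powR_gt0.
rewrite -powR_mulrn ?powR_ge0 // -powRrM mulVf ?powRr1 // ?ltW //.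
by rewrite pnatr_eq0 -lt0n.
Qed.

(** On a single layer, multiplication by s > 0 is the dilation of ratio
    s^(1/q); for s < 0, use that inversion preserves the distance to 0. *)
Lemma hdist_layer (q : nat) w (s : R) : (0 < q)%N -> layer (gdeg G) q w ->
  d 0 (s *: w) ^+ q = `|s| * d 0 w ^+ q.
Proof.
move=> q0 lw.
have pos (t : R) : 0 < t -> d 0 (t *: w) ^+ q = t * d 0 w ^+ q.
  move=> t0; have [r r0 rq] := root_exists q0 t0.
  have -> : t *: w = dil r w.
    apply/rowP => j; rewrite dilationE mxE.
    have [->|ne] := eqVneq (gdeg G j) q; first by rewrite rq.
    by rewrite lw // !mulr0.
  by rewrite hdist_dilation // exprMn rq.
have [s0|s0|->] := ltgtP s 0.
- by rewrite ltr0_norm // -hdist_opp -scaleNr pos ?oppr_gt0.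
- by rewrite gtr0_norm // pos.
- by rewrite scale0r hdist_refl expr0n gtn_eqF // normr0 mul0r.
Qed.

Lemma rV_norm_coord v j : `|v 0 j| <= `|v|.
Proof. by rewrite [leRHS]/Num.Def.normr/= mx_normrE; exact: (le_bigmax _ _ (0, j)). Qed.

Lemma rV_norm_le v (a : R) : 0 <= a -> (forall j, `|v 0 j| <= a) -> `|v| <= a.
Proof.
move=> a0 h; rewrite [leLHS]/Num.Def.normr/= mx_normrE; apply: bigmax_le => // -[i j] _ /=.
by rewrite ord1.
Qed.

Lemma hdist_sphere : exists2 kappa : R, 0 < kappa & forall v, `|v| = 1 -> kappa <= d 0 v.
Proof.
pose S := [set v : V | `|v| = 1].
have [S0|/nonemptyPn S0] := pselect (S !=set0); last first.
  by exists 1 => // v hv; exfalso; have : S v by []; rewrite S0.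
have cS : compact S.
  apply: bounded_closed_compact.
    by exists 1; split => // M hM v Sv /=; rewrite (Sv : `|v| = 1); exact: ltW.
  have -> : S = Num.Def.normr @^-1` [set (1:R)] by [].
  apply: preimage_closed; last exact: closed_eq.
  by move=> v _; exact: norm_continuous.
have [v] := EVT_min_rV S0 cS (continuous_subspaceT (@continuous_hdist 0)).
rewrite inE => Sv hv; exists (d 0 v); last by move=> w hw; apply: hv; rewrite inE.
by apply: hdist_gt0; rewrite -normr_gt0 Sv.
Qed.

Lemma continuous_dilation_path v : continuous (fun s => dil s v).
Proof.
move=> s; apply: cvg_row => j; rewrite dilationE; under eq_fun do rewrite dilationE.
by apply: cvgM; [exact: exprn_continuous | exact: cvg_cst].
Qed.

(** A homogeneous distance controls the norm.  A vector of norm at least 1 can be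
    dilated by some s in ]0, 1] to norm exactly 1 (intermediate value theorem),
    where d(0, .) is at least kappa; dividing by s only increases it. *)
Lemma hdist_bounded : exists2 kappa : R, 0 < kappa & forall v, d 0 v < kappa -> `|v| < 1.
Proof.
have [kappa k0 hk] := hdist_sphere; exists kappa => // v; apply: contraTT.
rewrite -!leNgt => v1.
have cn : {within `[(0:R), 1], continuous (fun s => `|dil s v|)}.
  apply: continuous_subspaceT => s.
  exact: (continuous_comp (continuous_dilation_path (x := s)) (@norm_continuous _ _ _)).
have d0v : dil 0 v = 0.
  by apply/rowP => j; rewrite dilationE mxE expr0n gtn_eqF ?mul0r // gdeg_gt0.
have [|s] := IVT ler01 cn (v := 1).
  by rewrite d0v normr0 dilation1 ge_min ler01 /= le_max v1 orbT.
rewrite in_itv /= => /andP[s0 s1] sv.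
have sp : 0 < s.
  by rewrite lt0r s0 andbT; apply: contra_eq_neq sv => ->; rewrite d0v normr0 eq_sym oner_eq0.
apply: (le_trans (hk _ sv)); rewrite hdist_dilation //.
by rewrite ler_piMl // hdist_ge0.
Qed.

(** Since all degrees are at least 1, dilating by s <= 1 shrinks the norm at least
    by the factor s. *)
Lemma hdist_small (e : R) : 0 < e ->
  exists2 r, 0 < r & forall v, d 0 v < r -> `|v| < e.
Proof.
move=> e0; have [kappa k0 hk] := hdist_bounded.
pose s := Num.min e 1; have s0 : 0 < s by rewrite lt_min e0 ltr01.
have s1 : s <= 1 by rewrite ge_min lexx orbT.
have se : s <= e by rewrite ge_min lexx.
exists (kappa * s); first by rewrite mulr_gt0.
move=> v dv; have sV : 0 < s^-1 by rewrite invr_gt0.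
have h1 : `|dil s^-1 v| < 1.
  by apply: hk; rewrite hdist_dilation // mulrC ltr_pdivrMr.
apply: (@le_lt_trans _ _ (s * `|dil s^-1 v|)); last first.
  by apply: lt_le_trans se; rewrite gtr_pMr.
apply: rV_norm_le; first by rewrite mulr_ge0 // ltW.
move=> j; rewrite -[v](dilationK G (r := s)) ?gt_eqF // dilationE normrM.
rewrite dilationK ?gt_eqF //.
apply: ler_pM => //; last exact: rV_norm_coord.
by rewrite gtr0_norm ?exprn_gt0 // ler_iXnr ?gdeg_gt0 // ltW.
Qed.

End HomogeneousDistance.

(** * Local parametrizations *)

Section LocalParam.
Context (R : realType) (n : nat) (Sigma : set 'rV[R]_n).
Local Notation V := 'rV[R]_n.

Lemma open_itvoo (a b : R) : open `]a, b[%classic.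
Proof. exact: interval_open. Qed.

Lemma local_param_image gamma a b t : local_param Sigma gamma a b -> t \in `]a, b[ ->
  Sigma (gamma t).
Proof.
move=> [_ _ _ /(_ `]a, b[%classic (@open_itvoo a b) (fun _ => id))] [U oU UE] tab.
have : (gamma @` [set` `]a, b[]) (gamma t) by exists t.
by rewrite UE => -[].
Qed.

Lemma local_param_derive (gamma : R -> V) (a b t : R) :
  local_param Sigma gamma a b -> t \in `]a, b[ ->
  is_derive t (1 : R) gamma (derive1 gamma t).
Proof.
by move=> [_ h _ _] /h [d _ _]; split; [exact: d|rewrite derive1E].
Qed.

Lemma local_param_continuous (gamma : R -> V) (a b t : R) :
  local_param Sigma gamma a b -> t \in `]a, b[ ->
  {for t, continuous gamma}.
Proof.
move=> lp tab; have [d _] := local_param_derive lp tab.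
exact/differentiable_continuous/derivable1_diffP.
Qed.

Lemma local_param_nbhs (gamma : R -> V) (a b t delta : R) :
  local_param Sigma gamma a b -> t \in `]a, b[ -> 0 < delta ->
  exists2 U : set V, open U /\ U (gamma t) &
    forall y, Sigma y -> U y ->
      exists s, [/\ s \in `]a, b[, `|s - t| < delta & gamma s = y].
Proof.
move=> lp tab d0; have [_ _ _ /(_ (`]a, b[%classic `&` ball t delta))] := lp.
case.
- apply: openI; first exact: open_itvoo.
  exact: ball_open.
- by move=> s [].
move=> U oU UE; have tV : (gamma @` (`]a, b[%classic `&` ball t delta)) (gamma t).
  by exists t => //; split => //; exact: ballxx.
exists U; first by split => //; move: tV; rewrite UE => -[].
move=> y Sy Uy; have : (Sigma `&` U) y by [].
rewrite -UE => -[s [sab st] <-]; exists s; split => //.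
by rewrite distrC.
Qed.

Lemma slope_near (f : R -> R) (t l e : R) : is_derive t (1 : R) f l -> 0 < e ->
  \forall s \near t, `|f s - f t - l * (s - t)| <= e * `|s - t|.
Proof.
move=> [df <-] e0.
have /cvgrPdist_le/(_ _ e0) : h^-1 *: ((f \o shift t) (h *: 1) - f t) @[h --> 0^'] --> 'D_1 f t.
  exact: df.
move=> [d /= d0 hd]; exists d => //= s st.
have [->|ne] := eqVneq s t; first by rewrite !subrr mulr0 subrr !normr0 mulr0.
have st0 : s - t != 0 by rewrite subr_eq0.
have st' : ball_ Num.Def.normr 0 d (s - t) by rewrite /= sub0r normrN distrC.
have := hd _ st' st0.
rewrite /= [(s - t) *: 1]mulr1 subrK => h.
rewrite -(ler_pM2r (x := `|s - t|)) ?normr_gt0 // -normrM in h.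
apply: (le_trans _ h); rewrite mulrBl /GRing.scale /= mulrAC mulVf // mul1r.
by rewrite -normrN opprB.
Qed.

(** Near the common point the second curve runs in the image of the first one,
    with parameters close to t1.  The function f measures the deviation from
    the line spanned by v1: along the first curve it is small compared with the
    i-coordinate of the displacement, hence so it is along the second one, and
    comparing first order terms gives f(v2) = 0. *)
Lemma local_param_parallel (g1 g2 : R -> V) (a1 b1 a2 b2 t1 t2 : R) :
  local_param Sigma g1 a1 b1 -> t1 \in `]a1, b1[ ->
  local_param Sigma g2 a2 b2 -> t2 \in `]a2, b2[ -> g1 t1 = g2 t2 ->
  exists c : R, derive1 g2 t2 = c *: derive1 g1 t1.
Proof.
move=> lp1 h1 lp2 h2 e12.
have d1 := local_param_derive lp1 h1; have d2 := local_param_derive lp2 h2.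
have v10 : derive1 g1 t1 != 0 by have [_ /(_ _ h1)[]] := lp1.
move: (derive1 g1 t1) (derive1 g2 t2) d1 d2 v10 => v1 v2 d1 d2 v10.
have [i vi] : exists i, v1 0 i != 0.
  apply/existsP; rewrite -negb_forall; apply: contra v10 => /forallP h.
  by apply/eqP/rowP => j; rewrite mxE; apply/eqP.
exists (v2 0 i / v1 0 i); apply/rowP => j; rewrite mxE.
have vi0 : 0 < `|v1 0 i| by rewrite normr_gt0.
suff E : v1 0 i * v2 0 j - v1 0 j * v2 0 i = 0.
  apply: (mulfI vi); rewrite mulrA mulrCA mulfV // mulr1.
  by rewrite [RHS]mulrC; apply/eqP; rewrite -subr_eq0 E.
pose f (g : R -> V) s := v1 0 i * g s 0 j - v1 0 j * g s 0 i.
have df (g : R -> V) t v : is_derive t (1 : R) g v ->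
    is_derive t (1 : R) (f g) (v1 0 i * v 0 j - v1 0 j * v 0 i).
  move=> dg; have dgj := is_derive_coord j dg; have dgi := is_derive_coord i dg.
  exact: (is_deriveB (is_deriveZ (v1 0 i) dgj) (is_deriveZ (v1 0 j) dgi)).
apply/eqP; rewrite -normr_le0; apply/ler_addgt0Pl => e e0; rewrite addr0.
pose K := `|v2 0 i| + 1; have K0 : 0 < K by rewrite ltr_wpDl.
pose e1 := e / (3 * K) * (`|v1 0 i| / 2).
have e10 : 0 < e1 by rewrite mulr_gt0 // divr_gt0 // mulr_gt0.
have [dl1 /= dl10 hdl1] := slope_near (df _ _ _ d1) e10.
have vi20 : 0 < `|v1 0 i| / 2 by rewrite divr_gt0.
have [dl2 /= dl20 hdl2] := slope_near (is_derive_coord i d1) vi20.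
(* Since v1_i is not zero, |s - t1| is bounded by a multiple of the
   i-coordinate of the displacement. *)
have small : exists2 dl, 0 < dl & forall s, `|s - t1| < dl ->
    `|f g1 s - f g1 t1| <= e / (3 * K) * `|g1 s 0 i - g1 t1 0 i|.
  exists (Num.min dl1 dl2); first by rewrite lt_min dl10 dl20.
  move=> s; rewrite lt_min distrC => /andP[s1 s2].
  have := hdl1 s s1; have := hdl2 s s2 => /=.
  rewrite [v1 0 i * v1 0 j]mulrC subrr mul0r subr0 => A B.
  have M0 : 0 < e / (3 * K) by rewrite divr_gt0 // mulr_gt0.
  apply: (le_trans B); rewrite /e1 -[_ * `|s - t1|]mulrA ler_pM2l //.
  have := ler_normB (g1 s 0 i - g1 t1 0 i) (g1 s 0 i - g1 t1 0 i - v1 0 i * (s - t1)).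
  rewrite subKr normrM => C.
  by lra.
have [dl dl0 hdl] := small.
have [U [oU Ux] hU] := local_param_nbhs lp1 h1 dl0.
have c2 := local_param_continuous lp2 h2.
have nU : \forall s \near t2, U (g2 s).
  by apply: c2; apply: open_nbhs_nbhs; split => //; rewrite -e12.
have e30 : 0 < e / 3 by rewrite divr_gt0.
have n1 := slope_near (df _ _ _ d2) e30.
have n2 := slope_near (is_derive_coord i d2) (ltr01 : 0 < (1 : R)).
have near_t2' : nbhs (t2^') (fun s => (s \in `]a2, b2[) /\ U (g2 s) /\
   (`|f g2 s - f g2 t2 - (v1 0 i * v2 0 j - v1 0 j * v2 0 i) * (s - t2)| <= e / 3 * `|s - t2|) /\
   (`|g2 s 0 i - g2 t2 0 i - v2 0 i * (s - t2)| <= 1 * `|s - t2|)).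
  apply: nbhs_dnbhs; exact: (filterI (near_in_itvoo h2) (filterI nU (filterI n1 n2))).
have [s [[sab [Us [A B]]] st]] := filter_ex (filterI near_t2' (nbhs_dnbhs_neq t2)).
have [t [tab tt1 gE]] := hU _ (local_param_image lp2 sab) Us.
have st0 : 0 < `|s - t2| by rewrite normr_gt0 subr_eq0.
have C := hdl t tt1; rewrite /f gE e12 in C; rewrite /f in A.
rewrite -(ler_pM2r st0) -normrM.
set L := _ - v1 0 j * v2 0 i in A *.
set F := _ - (v1 0 i * g2 t2 0 j - _) in A C.
have D : `|g2 s 0 i - g2 t2 0 i| <= K * `|s - t2|.
  have := ler_normD (g2 s 0 i - g2 t2 0 i - v2 0 i * (s - t2)) (v2 0 i * (s - t2)).
  by rewrite subrK normrM /K mulrDl mul1r; lra.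
have C' : `|F| <= e / 3 * `|s - t2|.
  apply: (le_trans C); rewrite (le_trans (ler_wpM2l _ D)) //.
    by rewrite divr_ge0 ?mulr_ge0 ?ltW.
  by rewrite mulrA invfM mulrA divfK ?gt_eqF.
have H := ler_normB F (F - L * (s - t2)); rewrite subKr in H.
have P : 0 <= e / 3 * `|s - t2| by rewrite mulr_ge0 ?ltW.
move: A C' H P; move: `|F| `|F - _| `|L * _| `|s - t2| => a1' a2' a3' a4' A C' H P.
by clear -A C' H P; lra.
Qed.

End LocalParam.

(** * Velocity and distance along the curve *)

Lemma near0N (R : realType) (P : set R) :
  (\forall u \near (0 : R), P u) -> \forall u \near (0 : R), P (- u).
Proof.
move=> [e /= e0 he]; exists e => //= u; rewrite /= sub0r normrN => ue.
by apply: he; rewrite /= sub0r opprK.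
Qed.

Section CurveInGroup.
Context (R : realType) (n : nat) (G : gradedGroup R n).
Local Notation V := 'rV[R]_n.
Local Notation m := (gmul G).
Local Notation M := (fun p : V * V => gmul G p.1 p.2).
Local Notation deg := (gdeg G).
Context (Sigma : set V).

Lemma dl_cvg (T : Type) (F : set_system T) {FF : Filter F} (f g v : T -> V) (a b w : V) :
  f p @[p --> F] --> a -> g p @[p --> F] --> b -> v p @[p --> F] --> w ->
  dl m (f p) (g p) (v p) @[p --> F] --> dl m a b w.
Proof.
move=> fa gb vw.
have dls p q u : dl m p q u = \sum_j u 0 j *: 'D_(0, delta_mx 0 j) M (p, q).
  rewrite (linear_row_sum _ (fun c u' w' => dlP G c p q u' w')).
  by apply: eq_bigr => j _; rewrite dlE.
rewrite dls; under eq_fun do rewrite dls.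
have cT j : v p 0 j *: 'D_(0, delta_mx 0 j) M (f p, g p) @[p --> F] -->
    w 0 j *: 'D_(0, delta_mx 0 j) M (a, b).
  apply: cvgZ; first exact: cvg_coord.
  have cpair : (f p, g p) @[p --> F] --> (a, b) by exact: (cvg_pair fa gb).
  exact: (cvg_comp _ _ cpair (@continuous_partial_gmul _ _ G (0, delta_mx 0 j) (a, b))).
pose Tj j p := v p 0 j *: 'D_(0, delta_mx 0 j) M (f p, g p).
by apply: (@cvg_big _ _ _ _ xpredT _ _ _ _ Tj) => [|j _]; [exact: add_continuous|exact: cT].
Qed.

(** The velocity of the curve read in the Lie algebra; its j-th coordinate is the
    coefficient of the tangent vector along X_j. *)
Definition body_velocity (gamma : R -> V) t : V :=
  maurer_cartan G (gamma t) (derive1 gamma t).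

Lemma left_inv_field_body_velocity gamma t :
  left_inv_field m (body_velocity gamma t) (gamma t) = derive1 gamma t.
Proof. exact: dlNK. Qed.

(** Left translations preserve left invariant fields, so the translated curve has
    the same velocity in the Lie algebra. *)
Lemma is_derive_translated gamma a b t x : local_param Sigma gamma a b -> t \in `]a, b[ ->
  is_derive t (1 : R) (fun s : R => m (- x) (gamma s))
    (left_inv_field m (body_velocity gamma t) (m (- x) (gamma t))).
Proof.
move=> lp tab; have := is_derive_gmull G (- x) (local_param_derive lp tab).
rewrite /left_inv_field /body_velocity /maurer_cartan.
have := dl_comp G (m (- x) (gamma t)) (- gamma t) (gamma t) (derive1 gamma t).
by rewrite gmulNx gmulxK => ->.
Qed.

Lemma body_velocity_continuous gamma a b t : local_param Sigma gamma a b -> t \in `]a, b[ ->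
  {for t, continuous (body_velocity gamma)}.
Proof.
move=> lp tab; have cg := local_param_continuous lp tab.
have cd : {for t, continuous (derive1 gamma)} by have [_ /(_ _ tab)[]] := lp.
by rewrite /body_velocity; apply: dl_cvg => //; apply: cvgN.
Qed.

Lemma body_velocity_degree q gamma a b t j : has_degree G Sigma q ->
  local_param Sigma gamma a b -> t \in `]a, b[ -> (q < deg j)%N ->
  body_velocity gamma t 0 j = 0.
Proof.
move=> [_ hq] lp tab; apply: contraTeq => lj; rewrite -leqNgt.
have g0 : derive1 gamma t != 0 by have [_ /(_ _ tab)[]] := lp.
pose k := (\max_(i | (body_velocity gamma t 0 i != 0)%R) deg i)%N.
have : has_pointwise_degree G Sigma (gamma t) k.
  exists (derive1 gamma t), (fun i => body_velocity gamma t 0 i); split => //.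
    by exists gamma, a, b, t, 1; split => //; rewrite scale1r.
  by rewrite -{1}left_inv_field_body_velocity left_inv_field_sum.
move=> /(hq _ _ (local_param_image lp tab)); apply: leq_trans.
exact: (@leq_bigmax_cond _ (fun i => body_velocity gamma t 0 i != 0) (fun i => deg i) j lj).
Qed.

(** The degree of the point may be witnessed by another parametrization; its
    tangent vector is parallel to that of gamma, and a nonzero factor does not
    change which coordinates vanish. *)
Lemma body_velocity_degree_attained q gamma a b t x : has_pointwise_degree G Sigma x q ->
  local_param Sigma gamma a b -> t \in `]a, b[ -> gamma t = x ->
  exists2 k, deg k = q & body_velocity gamma t 0 k != 0.
Proof.
move=> [tau [lam [[g1 [a1 [b1 [t1 [c1 [lp1 h1 e1 tauE]]]]]] tau0 tauS qE]]] lp tab gE.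
have [c cE] : exists c, derive1 g1 t1 = c *: derive1 gamma t.
  by apply: (local_param_parallel lp tab lp1 h1); rewrite gE e1.
pose L : V := \row_j lam j.
have LE : dl m (- x) x tau = L.
  rewrite -[RHS](dlK G x); congr dl; rewrite tauS.
  rewrite -/(left_inv_field m L x) left_inv_field_sum.
  by apply: eq_bigr => j _; rewrite [L 0 j]mxE.
have LbE : L = (c1 * c) *: body_velocity gamma t.
  by rewrite -LE tauE cE scalerA dlZ /body_velocity /maurer_cartan gE.
have [j lj] : exists j, lam j != 0.
  case: (pickP (fun j => lam j != 0)) => [j lj|h]; first by exists j.
  move/eqP: tau0; case; rewrite tauS; apply: big1 => j _.
  by move/negbFE/eqP: (h j) => ->; exact: scale0r.
have [k lk kE] : {k | lam k != 0 & (\max_(j | (lam j != 0)%R) gdeg G j)%N = deg k}.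
  have := @eq_bigmax_cond _ [pred j | lam j != 0] (fun j => deg j).
  by case=> [|k lk kE]; [apply/card_gt0P; exists j|exists k].
exists k; first by rewrite qE.
have : L 0 k != 0 by rewrite mxE.
by rewrite LbE mxE mulf_eq0 negb_or => /andP[].
Qed.

Context (d : V -> V -> R) (hd : homogeneous_distance G d).

Lemma blowup_hdist (q : nat) (y lam : R -> V) (e : R) : (0 < q)%N -> 0 < e -> y 0 = 0 ->
  (\forall u \near (0 : R), is_derive u (1 : R) y (left_inv_field m (lam u) (y u))) ->
  (\forall u \near (0 : R), forall j, (q < deg j)%N -> lam u 0 j = 0) ->
  {for 0, continuous lam} ->
  exists2 delta, 0 < delta & forall u, 0 < u < delta ->
    `|d 0 (y u) ^+ q - d 0 (proj_layer G q (lam 0)) ^+ q * u| <= e * u.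
Proof.
move=> q0 e0 y0 dy lq clam.
have := curve_blowup q0 y0 dy lq clam; set c := proj_layer G q (lam 0) => cb.
have c1 : d 0 (dilation G r^-1 (y (r ^+ q))) @[r --> (0:R)^'+] --> d 0 c.
  exact: (cvg_comp _ _ cb (continuous_hdist hd (x := 0) (x0 := c))).
have c2 : d 0 (dilation G r^-1 (y (r ^+ q))) ^+ q @[r --> (0:R)^'+] --> d 0 c ^+ q.
  exact: (cvg_comp _ _ c1 (@exprn_continuous _ q (d 0 c))).
have [dl /= dl0 hdl] := (cvgrPdist_le _ _).1 c2 _ e0.
exists (dl ^+ q); first by rewrite exprn_gt0.
move=> u /andP[u0 ud]; have [r r0 rE] := root_exists q0 u0.
have rd : r < dl.
  rewrite ltNge; apply/negP => dlr; have : dl ^+ q <= r ^+ q.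
    by apply: lerXn2r => //; rewrite nnegrE ltW.
  by rewrite rE leNgt ud.
have rV0 : 0 < r^-1 by rewrite invr_gt0.
have := hdl r; rewrite /= sub0r normrN gtr0_norm // => /(_ rd r0).
rewrite rE (hdist_dilation hd) // exprMn exprVn rE => h.
have -> : d 0 (y u) ^+ q - d 0 c ^+ q * u = (u^-1 * d 0 (y u) ^+ q - d 0 c ^+ q) * u.
  by rewrite mulrBl [u^-1 * _]mulrC divfK ?gt_eqF.
by rewrite normrM (gtr0_norm u0) ler_pM2r // distrC.
Qed.

(** [blowup_hdist] applies on both sides of t0: for t < t0 to the reversed curve,
    whose limit - c is at the same distance from 0 as c. *)
Lemma hdist_curve (q : nat) gamma a b t0 (e : R) : (0 < q)%N -> 0 < e -> has_degree G Sigma q ->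
  local_param Sigma gamma a b -> t0 \in `]a, b[ ->
  let kappa := d 0 (proj_layer G q (body_velocity gamma t0)) ^+ q in
  exists2 delta, 0 < delta & forall t, `|t - t0| < delta ->
    `|d (gamma t0) (gamma t) ^+ q - kappa * `|t - t0| | <= e * `|t - t0|.
Proof.
move=> q0 e0 hq lp h0 kappa.
have nab : \forall u \near (0:R), t0 + u \in `]a, b[.
  have := near_in_itvoo h0; rewrite -{1}[t0]addr0.
  have c0 : {for 0, continuous (fun u : R => t0 + u)}.
    by apply: cvgD; [exact: cvg_cst|exact: cvg_id].
  exact: c0.
pose y u := m (- gamma t0) (gamma (t0 + u)); pose lam u := body_velocity gamma (t0 + u).
have y0 : y 0 = 0 by rewrite /y addr0 gmulNx.
have dy : \forall u \near (0:R), is_derive u (1 : R) y (left_inv_field m (lam u) (y u)).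
  near=> u.
  have tab : t0 + u \in `]a, b[ by near: u.
  have ds : is_derive u (1 : R) (fun u : R => t0 + u) 1.
    by rewrite -[X in is_derive _ _ _ X]add0r; apply: is_deriveD.
  have := is_derive_comp1 ds (is_derive_translated (gamma t0) lp tab).
  by rewrite scale1r.
have lq : \forall u \near (0:R), forall j, (q < deg j)%N -> lam u 0 j = 0.
  by near=> u => j jq; apply: (body_velocity_degree hq lp) => //; near: u.
have clam : {for 0, continuous lam}.
  have c0 : {for 0, continuous (fun u : R => t0 + u)}.
    by apply: cvgD; [exact: cvg_cst|exact: cvg_id].
  have := body_velocity_continuous lp h0; rewrite -{1}[t0]addr0.
  exact: continuous_comp c0.
have N0 : -%R @ (0:R) --> (0:R) by rewrite -{2}oppr0; exact: opp_continuous.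
have dyN : \forall u \near (0:R),
    is_derive u (1 : R) (y \o -%R) (left_inv_field m (- lam (- u)) (y (- u))).
  apply: filterS (near0N dy) => u du.
  have := is_derive_comp1 (is_deriveN (is_derive_id u (1 : R))) du.
  rewrite scaleN1r; congr is_derive.
  by rewrite /left_inv_field -[- lam (- u)]scaleN1r dlZ scaleN1r.
have lqN : \forall u \near (0:R), forall j, (q < deg j)%N -> (- lam (- u)) 0 j = 0.
  by apply: filterS (near0N lq) => u h j /h; rewrite mxE => ->; rewrite oppr0.
have clamN : {for 0, continuous (fun u : R => - lam (- u))}.
  rewrite /prop_for /continuous_at oppr0; apply: cvgN.
  exact: (cvg_comp _ _ N0 clam).
have [d1 d10 h1] := blowup_hdist q0 e0 y0 dy lq clam.
have yN0 : (y \o -%R) 0 = 0 by rewrite /= oppr0.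
have [d2 d20 h2] := blowup_hdist q0 e0 yN0 dyN lqN clamN.
exists (Num.min d1 d2); first by rewrite lt_min d10 d20.
move=> t; rewrite lt_min => /andP[t1 t2].
have l0 : lam 0 = body_velocity gamma t0 by rewrite /lam addr0.
rewrite (hdist_left hd).
have yE : m (- gamma t0) (gamma t) = y (t - t0) by rewrite /y addrC subrK.
rewrite yE; have [tt|tt|tt] := ltgtP t t0.
- have := h2 (- (t - t0)); rewrite /= opprK oppr0 l0.
  have -> : proj_layer G q (- body_velocity gamma t0) = - proj_layer G q (body_velocity gamma t0).
    by apply/rowP => j; rewrite !mxE; case: ifP; rewrite ?oppr0.
  rewrite (hdist_opp hd) ltr0_norm ?subr_lt0 // in t2 *; apply.
  by rewrite t2 oppr_gt0 subr_lt0 tt.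
- have := h1 (t - t0); rewrite l0 gtr0_norm ?subr_gt0 // in t1 *; apply.
  by rewrite t1 andbT ?subr_gt0.
- rewrite tt subrr y0 normr0 !mulr0 subr0 (hdist_refl hd) expr0n gtn_eqF //.
  by rewrite normr0.
Unshelve. all: by end_near. Qed.

End CurveInGroup.

(** * Measure of small balls *)

Section Density.
Context (R : realType) (n : nat) (h : 'rV[R]_n -> 'M[R]_n) (hh : riemannian_metric h).
Local Notation V := 'rV[R]_n.

Lemma rnorm_gt0 (x v : V) : v != 0 -> 0 < rnorm h x v.
Proof. by move=> v0; rewrite sqrtr_gt0; have [_ _] := hh; exact. Qed.

Lemma rnorm_cvg (T : Type) (F : set_system T) {FF : Filter F} (f v : T -> V) (a w : V) :
  f p @[p --> F] --> a -> v p @[p --> F] --> w ->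
  rnorm h (f p) (v p) @[p --> F] --> rnorm h a w.
Proof.
move=> fa vw.
have [sh _ _] := hh.
pose Q (x u : V) := \sum_j (\sum_i u 0 i * h x i j) * u 0 j.
have QE x u : rnorm h x u = Num.sqrt (Q x u).
  rewrite /rnorm mxE; congr Num.sqrt; apply: eq_bigr => j _; rewrite !mxE.
  by congr (_ * _); apply: eq_bigr.
rewrite QE; under eq_fun do rewrite QE.
suff cQ : Q (f p) (v p) @[p --> F] --> Q a w.
  exact: (cvg_comp _ _ cQ (@sqrt_continuous _ _)).
have cH i j : h (f p) i j @[p --> F] --> h a i j.
  have ch := cvg_comp _ _ fa (smooth_continuous sh (x := a)).
  exact: (cvg_comp _ _ ch (@coord_continuous _ _ _ i j _)).
have cS j : \sum_i v p 0 i * h (f p) i j @[p --> F] --> \sum_i w 0 i * h a i j.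
  apply: (@cvg_big _ _ _ _ xpredT _ _ _ _ (fun i p => v p 0 i * h (f p) i j)) => [|i _].
    exact: add_continuous.
  by apply: cvgM; [exact: cvg_coord|exact: cH].
pose Qj j p := (\sum_i v p 0 i * h (f p) i j) * v p 0 j.
apply: (@cvg_big _ _ _ _ xpredT _ _ _ _ Qj) => [|j _].
  exact: add_continuous.
by apply: cvgM; [exact: cS|exact: cvg_coord].
Qed.

Lemma speed_continuous Sigma (gamma : R -> V) (a b t : R) :
  local_param Sigma gamma a b -> t \in `]a, b[ ->
  {for t, continuous (fun s => rnorm h (gamma s) (derive1 gamma s))}.
Proof.
move=> lp tab; apply: rnorm_cvg; first exact: (local_param_continuous lp tab).
by have [_ /(_ _ tab)[]] := lp.
Qed.

End Density.

Lemma dist_le_itv (R : realDomainType) (u v e : R) : `|u - v| <= e -> u - e <= v <= u + e.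
Proof. by rewrite ler_norml => /andP[? ?]; apply/andP; split; lra. Qed.

Section IntegralBounds.
Context (R : realType).
Local Notation mu := (@lebesgue_measure R).

Lemma lebesgue_centered_itv (t0 rho : R) : 0 < rho ->
  mu `]t0 - rho, t0 + rho[%classic = (2 * rho)%:E.
Proof.
move=> r0; rewrite lebesgue_measure_itv /= lte_fin.
have -> : t0 - rho < t0 + rho by lra.
by rewrite -EFinB; congr (_%:E); lra.
Qed.

Lemma integral_sandwich (T : set R) (D : R -> R) (t0 rho1 rho2 D1 D2 : R) :
  open T -> {in T, continuous D} -> 0 < rho1 -> 0 < rho2 -> 0 <= D1 -> 0 <= D2 ->
  `]t0 - rho1, t0 + rho1[%classic `<=` T -> T `<=` `]t0 - rho2, t0 + rho2[%classic ->
  (forall t, T t -> D1 <= D t <= D2) ->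
  ((D1 * (2 * rho1))%:E <= \int[mu]_(t in T) (D t)%:E <= (D2 * (2 * rho2))%:E)%E.
Proof.
move=> oT cD r1 r2 D10 D20 IT TI DT.
have mT : measurable T by exact: open_measurable.
have mD : measurable_fun T (fun t => (D t)%:E).
  by apply/measurable_EFinP; exact: open_continuous_measurable_fun.
set I1 : set R := `]t0 - rho1, t0 + rho1[%classic in IT *.
set I2 : set R := `]t0 - rho2, t0 + rho2[%classic in TI *.
have mI1 : measurable I1 by exact: measurable_itv.
have mI2 : measurable I2 by exact: measurable_itv.
have muI1 : mu I1 = (2 * rho1)%:E by exact: lebesgue_centered_itv.
have muI2 : mu I2 = (2 * rho2)%:E by exact: lebesgue_centered_itv.
apply/andP; split.
- apply: (@le_trans _ _ (\int[mu]_(t in I1) (D t)%:E)%E); last first.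
    by apply: ge0_subset_integral => // t /DT /andP[? _]; rewrite lee_fin (le_trans D10).
  have -> : (D1 * (2 * rho1))%:E = (\int[mu]_(t in I1) (cst D1%:E) t)%E.
    by rewrite integral_cst // EFinM; congr (_ * _)%E; exact: esym muI1.
  apply: ge0_le_integral => //.
  - by apply: measurable_funS mD.
  - by move=> t /IT/DT/andP[? _]; rewrite lee_fin.
- apply: (@le_trans _ _ (\int[mu]_(t in T) (cst D2%:E) t)%E).
    apply: ge0_le_integral => //.
    - by move=> t /DT/andP[? _]; rewrite lee_fin (le_trans D10).
    - by move=> t /DT/andP[_ ?]; rewrite lee_fin.
  rewrite integral_cst // EFinM lee_wpmul2l ?lee_fin //.
  by rewrite -muI2 le_measure // inE.
Qed.

End IntegralBounds.

Section BallMeasure.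
Context (R : realType) (n : nat) (G : gradedGroup R n)
    (d : 'rV[R]_n -> 'rV[R]_n -> R) (hd : homogeneous_distance G d)
    (h : 'rV[R]_n -> 'M[R]_n) (hh : riemannian_metric h)
    (Sigma : set 'rV[R]_n) (q : nat) (q0 : (0 < q)%N) (hq : has_degree G Sigma q)
    (mu : {measure set (g_sigma_algebraType (@open 'rV[R]_n)) -> \bar R})
    (hmu : riemannian_measure h Sigma mu).
Local Notation V := 'rV[R]_n.
Local Notation m := (gmul G).

Lemma open_dball x r : open (dball d x r).
Proof.
rewrite (_ : dball d x r = d x @^-1` [set z | z < r]) //.
apply: open_comp; last exact: open_lt.
by move=> y _; exact: (continuous_hdist hd).
Qed.

(** Small balls are small for the topology of the ambient space, so near the
    centre the ball sees only the part of the curve that gamma parametrizes. *)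
Lemma dball_nbhs x (U : set V) : open U -> U x ->
  exists2 r, 0 < r & dball d x r `<=` U.
Proof.
move=> oU Ux.
have cm : {for 0, continuous (m x)}.
  have [dm _] := is_derive_gmull G x (is_derive_id (0 : V) (0 : V)).
  apply: differentiable_continuous.
  apply: (@differentiable_comp _ _ _ _ (fun v => (x, v)) (fun p : V * V => gmul G p.1 p.2)).
    exact: differentiable_pair.
  exact: differentiable_gmul.
have : \forall v \near (0 : V), U (m x v).
  by apply: cm; apply: open_nbhs_nbhs; split => //; rewrite gmulx0.
move=> /nbhs_ballP[e /= e0 he]; have [r r0 hr] := hdist_small hd e0.
exists r => // y; rewrite /dball /= (hdist_left hd) => /hr ye.
rewrite -(gmulNKx G x y); apply: he.
by rewrite -ball_normE /= sub0r normrN.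
Qed.

(** The parameters of the points in the ball form an open set T squeezed between
    the intervals of half-lengths r^q / (kappa + e) and r^q / (kappa - e)
    around t0, and on T the density is within e of its value D0 at t0. *)
Lemma ball_measure_bounds (gamma : R -> V) (a b t0 e : R) :
  local_param Sigma gamma a b -> t0 \in `]a, b[ ->
  let kappa := d 0 (proj_layer G q (body_velocity G gamma t0)) ^+ q in
  let D0 := rnorm h (gamma t0) (derive1 gamma t0) in
  0 < e -> e < kappa -> e < D0 ->
  \forall r \near 0^'+,
    (((D0 - e) * (2 / (kappa + e)))%:E <=
      mu (Sigma `&` dball d (gamma t0) r) * ((r ^+ q)^-1)%:E <=
     ((D0 + e) * (2 / (kappa - e)))%:E)%E.
Proof.
move=> lp h0 kappa D0 e0 ek eD.
set x := gamma t0; pose D t := rnorm h (gamma t) (derive1 gamma t).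
have [dl1 dl10 hdl1] := hdist_curve hd q0 e0 hq lp h0.
have cD := speed_continuous hh lp h0.
have [dl2 /= dl20 hdl2] := (cvgrPdist_le _ _).1 cD _ e0.
have [dl3 /= dl30 hdl3] := near_in_itvoo h0.
pose dl := Num.min dl1 (Num.min dl2 dl3).
have dl0 : 0 < dl by rewrite !lt_min dl10 dl20 dl30.
have [U [oU Ux] hU] := local_param_nbhs lp h0 dl0.
have [r1 r10 hr1] := dball_nbhs oU Ux.
have [_ _ ginj _] := lp.
near=> r.
have r0 : 0 < r by near: r; exact: nbhs_right_gt.
have rr1 : r < r1 by near: r; exact: nbhs_right_lt.
have rlt1 : r < 1 by near: r; exact: nbhs_right_lt.
have rdl : r < dl * (kappa + e).
  by near: r; apply: nbhs_right_lt; rewrite mulr_gt0 // addr_gt0 // (lt_trans e0).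
have ke0 : 0 < kappa + e by rewrite addr_gt0 // (lt_trans e0).
have ke0' : 0 < kappa - e by rewrite subr_gt0.
have rq0 : 0 < r ^+ q by rewrite exprn_gt0.
have rqdl : r ^+ q < dl * (kappa + e).
  by apply: le_lt_trans rdl; apply: ler_iXnr => //; exact: ltW.
pose T := [set` `]a, b[] `&` gamma @^-1` (dball d x r).
have oT : open T.
  rewrite openE => t [/= tab tr].
  apply: filterI; first exact: near_in_itvoo.
  apply: (local_param_continuous lp tab).
  by apply: open_nbhs_nbhs; split => //; exact: open_dball.
have Tball t : T t -> `|t - t0| < dl.
  move=> [/= tab tr].
  have [s [sab st sE]] := hU _ (local_param_image lp tab) (hr1 _ (lt_trans tr rr1)).
  by rewrite -(ginj _ _ sab tab sE).
have lt_root (z : R) : 0 <= z -> (z ^+ q < r ^+ q) = (z < r).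
  by move=> z0; rewrite ltr_pXn2r // nnegrE // ltW.
have T1 : `]t0 - r ^+ q / (kappa + e), t0 + r ^+ q / (kappa + e)[%classic `<=` T.
  move=> t; rewrite /= in_itv /= => /andP[ta tb].
  have tt : `|t - t0| < r ^+ q / (kappa + e) by rewrite ltr_norml; apply/andP; split; lra.
  have tdl : `|t - t0| < dl by apply: (lt_trans tt); rewrite ltr_pdivrMr.
  have td1 : `|t - t0| < dl1 by apply: (lt_le_trans tdl); rewrite ge_min lexx.
  have td3 : `|t - t0| < dl3 by apply: (lt_le_trans tdl); rewrite !ge_min lexx !orbT.
  split; first by apply: hdl3; rewrite /= distrC.
  rewrite /= /dball /= -lt_root ?(hdist_ge0 hd) //.
  have := hdl1 t td1; rewrite ler_norml => /andP[_ H].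
  rewrite ltr_pdivlMr // in tt.
  apply: (@le_lt_trans _ _ (`|t - t0| * (kappa + e))) => //.
  by move: H; rewrite -/kappa mulrDr ![`|t - t0| * _]mulrC; lra.
have T2 : T `<=` `]t0 - r ^+ q / (kappa - e), t0 + r ^+ q / (kappa - e)[%classic.
  move=> t Tt; have tdl := Tball _ Tt.
  have td1 : `|t - t0| < dl1 by apply: (lt_le_trans tdl); rewrite ge_min lexx.
  have [_ /= tr] := Tt.
  rewrite /dball /= -lt_root ?(hdist_ge0 hd) // in tr.
  have : `|t - t0| < r ^+ q / (kappa - e).
    rewrite ltr_pdivlMr //; apply: le_lt_trans tr.
    have := hdl1 t td1; rewrite ler_norml -/kappa => /andP[H _].
    by move: H; rewrite mulrBr ![`|t - t0| * _]mulrC; lra.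
  by rewrite ltr_norml in_itv /= => /andP[? ?]; apply/andP; split; lra.
have DT t : T t -> D0 - e <= D t <= D0 + e.
  move=> Tt; have tdl := Tball _ Tt.
  have td2 : `|t - t0| < dl2 by apply: (lt_le_trans tdl); rewrite !ge_min lexx orbT.
  by apply: dist_le_itv; apply: hdl2; rewrite /= distrC.
(* For small r the trace of Sigma on the ball is the trace of the image of
   gamma, whose measure is an integral over T. *)
have muE : mu (Sigma `&` dball d x r) = (\int[lebesgue_measure]_(t in T) (D t)%:E)%E.
  have -> : Sigma `&` dball d x r = dball d x r `&` (gamma @` [set` `]a, b[]).
    apply/seteqP; split => y [].
      move=> Sy By; split => //.
      by have [s [sab _ sE]] := hU _ Sy (hr1 _ (lt_trans By rr1)); exists s.
    move=> By [s sab sE]; split => //.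
    by rewrite -sE; exact: (local_param_image lp sab).
  have [_ hm] := hmu; apply: (hm _ _ _ lp).
  by apply: sub_sigma_algebra; exact: open_dball.
have cDT : {in T, continuous D}.
  by move=> t; rewrite inE => -[/= tab _]; exact: (speed_continuous hh lp tab).
have rho1 : 0 < r ^+ q / (kappa + e) by rewrite divr_gt0.
have rho2 : 0 < r ^+ q / (kappa - e) by rewrite divr_gt0.
have D10 : 0 <= D0 - e by rewrite subr_ge0 ltW.
have D20 : 0 <= D0 + e by rewrite addr_ge0 // ?sqrtr_ge0 // ltW.
have := integral_sandwich oT cDT rho1 rho2 D10 D20 T1 T2 DT.
rewrite -muE => /andP[A B].
have E (c k : R) : (c * (2 / k))%:E = ((c * (2 * (r ^+ q / k)))%:E * ((r ^+ q)^-1)%:E)%E.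
  rewrite -EFinM; congr (_%:E); rewrite -!mulrA; congr (_ * (_ * _)).
  by rewrite mulrA mulrAC divff ?mul1r ?gt_eqF.
by rewrite !E !lee_pmul2r ?lte_fin ?invr_gt0 // A B.
Unshelve. all: by end_near. Qed.

End BallMeasure.

(** * The density theorem *)

Lemma ereal_squeeze_cvg (R : realType) (f : R -> \bar R) (lo hi : R -> R) (l : R) :
  lo e @[e --> 0^'+] --> l -> hi e @[e --> 0^'+] --> l ->
  (\forall e \near 0^'+, \forall r \near 0^'+, ((lo e)%:E <= f r <= (hi e)%:E)%E) ->
  f r @[r --> 0^'+] --> l%:E.
Proof.
move=> clo chi hf.
apply/fine_cvgP; split.
  have [e he] := @filter_ex _ _ (at_right_proper_filter (0 : R)) _ hf.
  near=> r; have /andP[A B] : ((lo e)%:E <= f r <= (hi e)%:E)%E by near: r.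
  by rewrite fin_real // (lt_le_trans _ A) ?ltNyr //= (le_lt_trans B) ?ltry.
apply/cvgrPdist_le => eps eps0.
have [e [he [A B]]] := @filter_ex _ _ (at_right_proper_filter (0 : R)) _ (filterI hf
  (filterI ((cvgrPdist_le _ _).1 clo _ eps0) ((cvgrPdist_le _ _).1 chi _ eps0))).
near=> r; have /andP[C D] : ((lo e)%:E <= f r <= (hi e)%:E)%E by near: r.
rewrite /=.
have fr : f r \is a fin_num.
  by rewrite fin_real // (lt_le_trans _ C) ?ltNyr //= (le_lt_trans D) ?ltry.
rewrite -(fineK fr) !lee_fin in C D.
by move: A B; rewrite !ler_norml => /andP[? ?] /andP[? ?]; apply/andP; split; lra.
Unshelve. all: by end_near. Qed.

(** The line spanned by w meets the unit ball where |s| d(0, w)^q < 1; the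
    length of that segment is a multiple of |w|, which cancels. *)
Lemma metric_factor_ratio (R : realType) (n : nat) (G : gradedGroup R n)
    (d : 'rV[R]_n -> 'rV[R]_n -> R) (hd : homogeneous_distance G d)
    (q : nat) (x w : 'rV[R]_n) : (0 < q)%N -> w != 0 -> layer (gdeg G) q w ->
  (metric_factor G d x (dl (gmul G) x 0 w) *
   ((left_inv_norm G x (dl (gmul G) x 0 w))^-1)%:E)%E = (2 / d 0 w ^+ q)%:E.
Proof.
move=> q0 w0 lw; rewrite /metric_factor /left_inv_norm dlK.
have dw0 : 0 < d 0 w ^+ q by rewrite exprn_gt0 // (hdist_gt0 hd).
have rho0 : 0 < (d 0 w ^+ q)^-1 by rewrite invr_gt0.
have lt1 z : (d 0 z < 1) = (d 0 z ^+ q < 1).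
  by rewrite -{2}(expr1n R q) ltr_pXn2r // nnegrE ?ler01 ?(hdist_ge0 hd).
rewrite (@hausdorff1_segment _ _ w _ _ rho0 w0).
  by rewrite -EFinM mulfK // gt_eqF // enorm_gt0.
apply/seteqP; split => z.
  move=> [[c _ <-]]; rewrite /dball /= lt1 (hdist_layer hd) // => hc.
  by exists c => //=; rewrite -ltr_pdivlMr // div1r in hc.
move=> [c /= hc <-]; split; first by exists c.
by rewrite /dball /= lt1 (hdist_layer hd) // -ltr_pdivlMr // div1r.
Qed.

Theorem theorem1p2 (R : realType) (n : nat) (G : gradedGroup R n)
    (d : 'rV[R]_n -> 'rV[R]_n -> R) (hd : homogeneous_distance G d)
    (h : 'rV[R]_n -> 'M[R]_n) (hh : riemannian_metric h)
    (Sigma : set 'rV[R]_n) (hSigma : C1_curve Sigma)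
    (q : nat) (hq : has_degree G Sigma q)
    (x : 'rV[R]_n) (hx : Sigma x) (hxq : has_pointwise_degree G Sigma x q)
    (mu : {measure set (g_sigma_algebraType (@open 'rV[R]_n)) -> \bar R})
    (hmu : riemannian_measure h Sigma mu)
    (tau : 'rV[R]_n) (htau : unit_tangent h Sigma x tau) :
  (mu (Sigma `&` dball d x r) * ((r ^+ q)^-1)%:E)%E @[r --> 0^'+] -->
  (metric_factor G d x (tangent_proj G q x tau) *
   ((left_inv_norm G x (tangent_proj G q x tau))^-1)%:E)%E.
Proof.
have [gamma [a [b [t0 [lp h0 gE ->]]]]] := htau.
have [k kq bk] := body_velocity_degree_attained hxq lp h0 gE.
have q0 : (0 < q)%N by rewrite -kq gdeg_gt0.
subst x; set D0 := rnorm _ _ _; set x := gamma t0.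
have D00 : 0 < D0 by apply: (rnorm_gt0 hh); have [_ /(_ _ h0)[]] := lp.
pose c := proj_layer G q (body_velocity G gamma t0).
have c0 : c != 0.
  by apply: contra bk => /eqP/rowP/(_ k); rewrite !mxE kq eqxx => ->.
have kappa0 : 0 < d 0 c ^+ q by rewrite exprn_gt0 // (hdist_gt0 hd).
have lc : layer (gdeg G) q c by move=> j /negPf jq; rewrite mxE jq.
have wE : proj_layer G q (dl (gmul G) (- x) x (D0^-1 *: derive1 gamma t0)) = D0^-1 *: c.
  by rewrite dlZ; apply/rowP => j; rewrite !mxE; case: ifP => _; rewrite ?mulr0.
rewrite /tangent_proj wE (metric_factor_ratio hd _ q0); last 2 first.
- by rewrite scaler_eq0 negb_or invr_eq0 gt_eqF.
- by move=> j jq; rewrite mxE (lc j jq) mulr0.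
rewrite (hdist_layer hd _ q0 lc) gtr0_norm ?invr_gt0 //.
have -> : 2 / (D0^-1 * d 0 c ^+ q) = D0 * (2 / d 0 c ^+ q) by rewrite invfM invrK mulrCA.
have ce : e @[e --> (0:R)^'+] --> (0:R) by apply: cvg_at_right_filter; exact: cvg_id.
have cc (z : R) : z @[_ --> (0:R)^'+] --> z by exact: cvg_cst.
have cp (z : R) : z + e @[e --> (0:R)^'+] --> z.
  by rewrite -[X in _ --> X]addr0; exact: (cvgD (cc z) ce).
have cm (z : R) : z - e @[e --> (0:R)^'+] --> z.
  by rewrite -[X in _ --> X]subr0; exact: (cvgB (cc z) ce).
have cq (f g : R -> R) (u v : R) : v != 0 -> f e @[e --> (0:R)^'+] --> u ->
    g e @[e --> (0:R)^'+] --> v -> f e * (2 / g e) @[e --> (0:R)^'+] --> u * (2 / v).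
  by move=> v0 fu gv; apply: cvgM fu _; apply: cvgM (cc _) _; exact: cvgV.
apply: (@ereal_squeeze_cvg _ _ (fun e => (D0 - e) * (2 / (d 0 c ^+ q + e)))
    (fun e => (D0 + e) * (2 / (d 0 c ^+ q - e)))).
- by apply: cq; [rewrite gt_eqF|exact: cm|exact: cp].
- by apply: cq; [rewrite gt_eqF|exact: cp|exact: cm].
near=> e.
apply: (ball_measure_bounds hd hh q0 hq hmu lp h0).
- by near: e; exact: nbhs_right_gt.
- by near: e; exact: nbhs_right_lt.
- by near: e; exact: nbhs_right_lt.
Unshelve. all: by end_near. Qed.
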